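(* Let $m\ge1$, $V=\mathbb R^{0,2m}$ and $S=S_{0,2m}$ its spinor module in the model of the context, with form $h$ and operators $E,I,J,K$ as there; write $h_A=h(A\cdot,\cdot)$, $j_A=j_\rho(h_A)$. (a) If $m\equiv0\pmod4$, every $\mathfrak{so}(0,2m)$-equivariant embedding $\mathbb R^{0,2m}\hookrightarrow(S\otimes S)^*$ is a linear combination of $$j_\rho(h):\mathbb R^{0,2m}\hookrightarrow(S^+\vee S^-)^*,\qquad j_\rho(h_E):\mathbb R^{0,2m}\hookrightarrow(S^+\wedge S^-)^*.$$ (b) If $m\equiv1\pmod4$, every such embedding is a linear combination of $j_\rho(h)$ and $j_\rho(h_J):\mathbb R^{0,2m}\hookrightarrow\vee^2S^*$. (c) If $m\equiv2$ or $3\pmod4$, every such embedding is a linear combination of the embeddings $j_A$, $A\in\{\mathrm{Id},I,J,K,E,EI,EJ,EK\}$, whose images are contained in the dual of the following subspaces. - $m\equiv2$: $j_{Id},j_J,j_K,j_{EI}$: $S^+\vee S^-$; $j_I,j_E,j_{EJ},j_{EK}$: $S^+\wedge S^-$. - $m\equiv3$: $j_{Id},j_{EI}$: $S^+\vee S^-$; $j_I,j_E$: $S^+\wedge S^-$; $j_J,j_K,j_{EJ},j_{EK}$: $\wedge^2S^++\wedge^2S^-$.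
   Context: $C\ell_{0,m}$ is the Clifford algebra of the negative definite space $\mathbb R^{0,m}$ with $v^2=-\langle v,v\rangle$; $\mathbb C\ell_m=C\ell_{0,m}\otimes\mathbb C$; $\alpha$ is the (complex linearly extended) involution equal to $+1$ on the even and $-1$ on the odd part; $\omega=e_1\cdots e_m$ is the volume element of $C\ell_{0,m}$ for an orthonormal basis; $L_\omega$ is left multiplication by $\omega$. Decompose orthogonally $\mathbb R^{0,2m}=\mathbb R^{0,m}+\widetilde{\mathbb R^{0,m}}$ with an isometry $x\mapsto\tilde x$. The irreducible $C\ell_{0,2m}$-module $S$ with Clifford multiplication $\rho$ is: - $m\equiv0$: $S=C\ell_{0,m}$, $\rho(x)s=xs$, $\rho(\tilde x)s=\omega sx$, $S^+=C\ell^0_{0,m}$, $S^-=C\ell^1_{0,m}$; - $m\equiv1$: $S=C\ell_{0,m}$, $\rho(x)s=xs$, $\rho(\tilde x)s=\omega\alpha(s)x$ (irreducible over $\mathfrak{so}(0,2m)$); - $m\equiv2,3$: $S=\mathbb C\ell_m$ as a real vector space, $\rho(x)s=xs$, $\rho(\tilde x)s=i\alpha(s)x$, $S^+=\mathbb C\ell^0_m$, $S^-=\mathbb C\ell^1_m$ (all mod 4, $x\in\mathbb R^{0,m}$). $h$ is the positive definite scalar product on $S$ invariant under $\rho(v)$ for unit vectors $v$ ($\langle v,v\rangle=-1$), unique up to scale. Operators: $E=\alpha$ if $m\equiv0,2,3$; $J=L_\omega\circ\alpha$ if $m\equiv1$; for $m\equiv2,3$: $I:s\mapsto is$, $J=L_\omega\circ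 c$, $K=IJ$, with $c$ complex conjugation of $\mathbb C\ell_m$ with respect to the real form $C\ell_{0,m}$. $j_\rho(\beta)(v)=\beta(\rho(v)\cdot,\cdot)$. Image in the dual of: $\vee^2S$ means all forms $j(v)$ are symmetric; $\wedge^2S^++\wedge^2S^-$: skew symmetric with $S^+\perp S^-$; $S^+\vee S^-$: symmetric with $S^\pm$ isotropic; $S^+\wedge S^-$: skew symmetric with $S^\pm$ isotropic. *)

(* Defs.v *)
From HB Require Import structures.
From mathcomp Require Import all_boot all_order all_algebra.
From mathcomp Require Import complex reals.
Set Implicit Arguments.
Unset Strict Implicit.
Unset Printing Implicit Defensive.
Import Order.TTheory GRing.Theory Num.Theory.
Local Open Scope ring_scope.

Definition dotneg (R : pzRingType) (n : nat) (u v : 'rV[R]_n) : R :=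
  - \sum_(i < n) u 0 i * v 0 i.

(* [cl K m] is the algebra over [K] generated by e_0, ..., e_(m-1) with
   e_i ^+ 2 = 1 and e_i e_j = - e_j e_i for i != j.  Its elements are the
   coordinate vectors with respect to the basis
   e_A = e_(i_1) ... e_(i_k),  A = {i_1 < ... < i_k}.
   As v^2 = - <v, v> and <.,.> is negative definite on R^{0,m}, the algebra
   [cl R m] is C\ell_{0,m}, and [cl R[i] m] is its complexification. *)
Definition cl (K : comNzRingType) (m : nat) : Type := {ffun {set 'I_m} -> K}.

Definition symdiff (T : finType) (A B : {set T}) : {set T} :=
  [set i | (i \in A) (+) (i \in B)].

(* Parity of the number of transpositions that sort e_A e_B, so that
   e_A e_B = (-1) ^+ cl_inv A B *: e_(symdiff A B). *)
Definition cl_inv (m : nat) (A B : {set 'I_m}) : bool :=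
  \big[addb/false]_(i < m) \big[addb/false]_(j < m)
    [&& i \in A, j \in B & (j < i)%N].

Section CliffordAlgebra.
Variables (K : comNzRingType) (m : nat).
Implicit Types (x y z : cl K m) (A B C D : {set 'I_m}).

HB.instance Definition _ := GRing.Zmodule.on (cl K m).

Definition blade A : cl K m := [ffun B => (B == A)%:R].

(* B = symdiff A C is the only set with symdiff A B = C. *)
Definition cl_mul x y : cl K m :=
  [ffun C => \sum_A (-1) ^+ cl_inv A (symdiff A C) * (x A * y (symdiff A C))].

Definition cl_scale (a : K) x : cl K m := [ffun A => a * x A].

Lemma symdiffC A B : symdiff A B = symdiff B A.
Proof. by apply/setP=> i; rewrite !inE addbC. Qed.

Lemma symdiffA A B C : symdiff A (symdiff B C) = symdiff (symdiff A B) C.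
Proof. by apply/setP=> i; rewrite !inE addbA. Qed.

Lemma symdiff0 A : symdiff set0 A = A.
Proof. by apply/setP=> i; rewrite !inE. Qed.

Lemma symdiffK A B : symdiff A (symdiff A B) = B.
Proof. by apply/setP=> i; rewrite !inE addbA addbb. Qed.

Lemma symdiff_eq0 A B : (symdiff A B == set0) = (A == B).
Proof.
apply/eqP/eqP=> [h|->]; last by apply/setP=> i; rewrite !inE addbb.
apply/setP=> i; have /setP/(_ i) := h; rewrite !inE.
by case: (i \in A); case: (i \in B).
Qed.

Lemma cl_invDl A B C : cl_inv (symdiff A B) C = cl_inv A C (+) cl_inv B C.
Proof.
rewrite /cl_inv -big_split; apply: eq_bigr => i _ /=.
rewrite -big_split; apply: eq_bigr => j _ /=; rewrite inE.
by case: (i \in A); case: (i \in B); case: (j \in C); case: (j < i)%N.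
Qed.

Lemma cl_invDr A B C : cl_inv A (symdiff B C) = cl_inv A B (+) cl_inv A C.
Proof.
rewrite /cl_inv -big_split; apply: eq_bigr => i _ /=.
rewrite -big_split; apply: eq_bigr => j _ /=; rewrite inE.
by case: (i \in A); case: (j \in B); case: (j \in C); case: (j < i)%N.
Qed.

Lemma cl_inv0l A : cl_inv set0 A = false.
Proof. by rewrite /cl_inv big1 // => i _; rewrite big1 // => j _; rewrite inE. Qed.

Lemma cl_inv0r A : cl_inv A set0 = false.
Proof.
by rewrite /cl_inv big1 // => i _; rewrite big1 // => j _; rewrite inE andbF.
Qed.

Lemma cl_mulA : associative cl_mul.
Proof.
move=> x y z; apply/ffunP=> D; rewrite !ffunE.
under eq_bigr => A _.
  rewrite ffunE (reindex_inj (inv_inj (symdiffK A))) /= !mulr_sumr.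
  over.
under [RHS]eq_bigr => C _.
  rewrite ffunE mulr_suml mulr_sumr.
  over.
rewrite exchange_big; apply: eq_bigr => C _; apply: eq_bigr => A _ /=.
have -> : symdiff (symdiff A C) (symdiff A D) = symdiff C D.
  by apply/setP=> i; rewrite !inE addbACA addbb.
set a := x A; set b := y _; set c := z _.
have -> : (-1) ^+ cl_inv A (symdiff A D) *
    (a * ((-1) ^+ cl_inv (symdiff A C) (symdiff C D) * (b * c))) =
    (-1) ^+ (cl_inv A (symdiff A D) (+) cl_inv (symdiff A C) (symdiff C D))
      * (a * (b * c)).
  by rewrite signr_addb (mulrCA a) !mulrA.
have -> : (-1) ^+ cl_inv C (symdiff C D) *
    ((-1) ^+ cl_inv A (symdiff A C) * (a * b) * c) =
    (-1) ^+ (cl_inv C (symdiff C D) (+) cl_inv A (symdiff A C))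
      * (a * (b * c)).
  by rewrite signr_addb !mulrA.
congr ((-1) ^+ nat_of_bool _ * _).
rewrite cl_invDl !cl_invDr.
by do ![case: (cl_inv _ _)].
Qed.

Lemma cl_mul1x : left_id (blade set0) cl_mul.
Proof.
move=> x; apply/ffunP=> C; rewrite ffunE (bigD1 set0) //= big1 => [|A /negPf nA].
  by rewrite cl_inv0l ffunE eqxx symdiff0 !mul1r addr0.
by rewrite ffunE nA mul0r mulr0.
Qed.

Lemma cl_mulx1 : right_id (blade set0) cl_mul.
Proof.
move=> x; apply/ffunP=> C; rewrite ffunE (bigD1 C) //= big1 => [|A /negPf nA].
  have -> : symdiff C C = set0 by apply/eqP; rewrite symdiff_eq0.
  by rewrite cl_inv0r ffunE eqxx mul1r mulr1 addr0.
by rewrite ffunE symdiff_eq0 nA !mulr0.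
Qed.

Lemma cl_mulDl : left_distributive cl_mul +%R.
Proof.
move=> x y z; apply/ffunP=> C; rewrite !ffunE -big_split; apply: eq_bigr => A _.
by rewrite ffunE mulrDl mulrDr.
Qed.

Lemma cl_mulDr : right_distributive cl_mul +%R.
Proof.
move=> x y z; apply/ffunP=> C; rewrite !ffunE -big_split; apply: eq_bigr => A _.
by rewrite ffunE !mulrDr.
Qed.

Lemma cl_1_neq0 : blade set0 != 0.
Proof.
by apply/eqP=> /ffunP/(_ set0); rewrite !ffunE eqxx; apply/eqP/oner_neq0.
Qed.

HB.instance Definition _ := GRing.Zmodule_isNzRing.Build (cl K m)
  cl_mulA cl_mul1x cl_mulx1 cl_mulDl cl_mulDr cl_1_neq0.

Lemma cl_scaleA a b x : cl_scale a (cl_scale b x) = cl_scale (a * b) x.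
Proof. by apply/ffunP=> A; rewrite !ffunE mulrA. Qed.

Lemma cl_scale1 : left_id 1 cl_scale.
Proof. by move=> x; apply/ffunP=> A; rewrite ffunE mul1r. Qed.

Lemma cl_scaleDr : right_distributive cl_scale +%R.
Proof. by move=> a x y; apply/ffunP=> A; rewrite !ffunE mulrDr. Qed.

Lemma cl_scaleDl x : {morph cl_scale^~ x : a b / a + b}.
Proof. by move=> a b; apply/ffunP=> A; rewrite !ffunE mulrDl. Qed.

HB.instance Definition _ := GRing.Zmodule_isLmodule.Build K (cl K m)
  cl_scaleA cl_scale1 cl_scaleDr cl_scaleDl.

Lemma cl_scaleAl a x y : a *: (x * y) = (a *: x) * y.
Proof.
apply/ffunP=> C; rewrite !ffunE mulr_sumr; apply: eq_bigr => A _.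
by rewrite !ffunE mulrCA !mulrA.
Qed.

HB.instance Definition _ := GRing.Lmodule_isLalgebra.Build K (cl K m) cl_scaleAl.

Lemma cl_scaleAr a x y : a *: (x * y) = x * (a *: y).
Proof.
apply/ffunP=> C; rewrite !ffunE mulr_sumr; apply: eq_bigr => A _.
by rewrite !ffunE mulrCA (mulrCA a).
Qed.

HB.instance Definition _ := GRing.Lalgebra_isAlgebra.Build K (cl K m) cl_scaleAr.

Definition cl_gen (i : 'I_m) : cl K m := blade [set i].

Definition cl_vec (v : 'rV[K]_m) : cl K m := \sum_(i < m) v 0 i *: cl_gen i.

Definition cl_omega : cl K m := \prod_(i < m) cl_gen i.

Definition cl_alpha x : cl K m := [ffun A : {set 'I_m} => (-1) ^+ #|A| * x A].

Definition cl_even x : Prop := forall A : {set 'I_m}, odd #|A| -> x A = 0.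
Definition cl_odd x : Prop := forall A : {set 'I_m}, ~~ odd #|A| -> x A = 0.

Lemma bladeM A B :
  blade A * blade B = (-1) ^+ cl_inv A B *: blade (symdiff A B).
Proof.
apply/ffunP=> C; rewrite !ffunE (bigD1 A) //= big1 => [|D /negPf nD].
  rewrite !ffunE eqxx mul1r addr0.
  have -> : (symdiff A C == B) = (C == symdiff A B).
    by apply/eqP/eqP=> [<-|->]; rewrite symdiffK.
  by case: (C =P _) => [->|]; rewrite ?symdiffK ?mulr0.
by rewrite !ffunE nD mul0r mulr0.
Qed.

Lemma cl_inv1 (i j : 'I_m) : cl_inv [set i] [set j] = (j < i)%N.
Proof.
rewrite /cl_inv (bigD1 i) //= [X in _ (+) X]big1 => [|k /negPf nk]; last first.
  by rewrite big1 // => l _; rewrite inE nk.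
rewrite (bigD1 j) //= big1 => [|l /negPf nl]; last by rewrite !inE nl andbF.
by rewrite !inE !eqxx !addbF.
Qed.

Lemma cl_gen_sqr i : cl_gen i * cl_gen i = 1.
Proof.
rewrite bladeM cl_inv1 ltnn scale1r; congr blade.
by apply/eqP; rewrite symdiff_eq0.
Qed.

Lemma cl_gen_anti i j : i != j -> cl_gen i * cl_gen j = - (cl_gen j * cl_gen i).
Proof.
move=> ij; rewrite !bladeM !cl_inv1 symdiffC -scaleNr.
have : i != j :> nat by [].
by case: ltngtP => // _ _; rewrite ?expr1 ?expr0 ?opprK.
Qed.

Lemma cl_vec_sqr (v : 'rV[K]_m) : cl_vec v * cl_vec v = (- dotneg v v)%:A.
Proof.
have term i j : (v 0 i *: cl_gen i) * (v 0 j *: cl_gen j)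
    = (v 0 i * v 0 j) *: (cl_gen i * cl_gen j).
  by rewrite -scalerAl -scalerAr scalerA.
rewrite /dotneg opprK scaler_suml /cl_vec mulr_suml.
under eq_bigr => i _.
  rewrite mulr_sumr (bigD1 i) //= term cl_gen_sqr.
  under eq_bigr => j _ do rewrite term.
  rewrite (bigID (fun j : 'I_m => (j < i)%N)) /=.
  over.
rewrite big_split -[RHS]addr0; congr (_ + _).
rewrite big_split /= addrC; apply/eqP; rewrite addr_eq0; apply/eqP.
rewrite -sumrN (exchange_big_dep predT) //=; apply: eq_bigr => j _.
rewrite -sumrN; apply: eq_big => [i|i /andP[ij _]].
  by rewrite -!(inj_eq val_inj) /= -leqNgt; case: (ltngtP i j).
by rewrite mulrC cl_gen_anti ?scalerN // eq_sym.
Qed.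

End CliffordAlgebra.

Section ComplexClifford.
Variables (R : realType) (m : nat).

(* The same ring as [cl R[i] m], but with scalars restricted to R. *)
Definition clC : Type := cl R[i] m.

HB.instance Definition _ := GRing.NzRing.on clC.

Definition clC_scale (a : R) (s : clC) : clC :=
  real_complex R a *: (s : cl R[i] m).

Lemma clC_scaleA a b s : clC_scale a (clC_scale b s) = clC_scale (a * b) s.
Proof. by rewrite /clC_scale scalerA rmorphM. Qed.

Lemma clC_scale1 : left_id 1 clC_scale.
Proof. by move=> s; rewrite /clC_scale rmorph1 scale1r. Qed.

Lemma clC_scaleDr : right_distributive clC_scale +%R.
Proof. by move=> a s t; rewrite /clC_scale scalerDr. Qed.

Lemma clC_scaleDl s : {morph clC_scale^~ s : a b / a + b}.
Proof. by move=> a b; rewrite /clC_scale rmorphD scalerDl. Qed.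

HB.instance Definition _ := GRing.Zmodule_isLmodule.Build R clC
  clC_scaleA clC_scale1 clC_scaleDr clC_scaleDl.

(* The inclusion of the real form C\ell_{0,m}. *)
Definition clC_of (x : cl R m) : clC :=
  [ffun A : {set 'I_m} => real_complex R (x A)].

Definition clC_alpha (s : clC) : clC := cl_alpha s.

Definition clC_conj (s : clC) : clC :=
  [ffun A : {set 'I_m} => conjc ((s : cl R[i] m) A)].

Definition clC_even (s : clC) : Prop := cl_even s.
Definition clC_odd (s : clC) : Prop := cl_odd s.

Definition opI (s : clC) : clC := (Complex 0 1 : R[i]) *: (s : cl R[i] m).
Definition opJ23 (s : clC) : clC := clC_of (cl_omega R m) * clC_conj s.
Definition opK (s : clC) : clC := opI (opJ23 s).

End ComplexClifford.

Definition opJ1 (R : realType) (m : nat) (s : cl R m) : cl R m :=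
  cl_omega R m * cl_alpha s.

(* R^{0,2m} is ['rV_(m + m)]: the left block is x, and the right block,
   through the isometry x |-> x~, is the complement. *)
Section Models.
Variables (R : realType) (m : nat).
Implicit Type v : 'rV[R]_(m + m).

Definition rho0 v (s : cl R m) : cl R m :=
  cl_vec (lsubmx v) * s + cl_omega R m * s * cl_vec (rsubmx v).

Definition rho1 v (s : cl R m) : cl R m :=
  cl_vec (lsubmx v) * s + cl_omega R m * cl_alpha s * cl_vec (rsubmx v).

Definition rho23 v (s : clC R m) : clC R m :=
  clC_of (cl_vec (lsubmx v)) * s
  + opI (clC_alpha s * clC_of (cl_vec (rsubmx v))).

End Models.

(* Elements of (S ⊗ S)^* are identified with bilinear forms on S. *)
Section Forms.
Variables (R : realType) (S : lmodType R).
Implicit Type b : S -> S -> R.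

Definition bilinear_form b : Prop :=
  (forall t, scalar (b^~ t)) /\ (forall s, scalar (b s)).

Definition symmetric_form b : Prop := forall s t, b s t = b t s.

Definition skew_form b : Prop := forall s t, b s t = - b t s.

Definition pos_def_form b : Prop := forall s, s != 0 -> 0 < b s s.

Definition form_op b (A : S -> S) : S -> S -> R := fun s t => b (A s) t.

(* The duals of the subspaces of S ⊗ S are the spaces of bilinear forms that
   vanish on a canonical complement. *)
Definition dual_vee2 b : Prop := bilinear_form b /\ symmetric_form b.

Variables Sp Sm : S -> Prop.

Definition isotropic (U : S -> Prop) b : Prop :=
  forall s t, U s -> U t -> b s t = 0.

Definition dual_wedge2_sum b : Prop :=
  [/\ bilinear_form b, skew_form b & forall s t, Sp s -> Sm t -> b s t = 0].

Definition dual_Sp_vee_Sm b : Prop :=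
  [/\ bilinear_form b, symmetric_form b, isotropic Sp b & isotropic Sm b].

Definition dual_Sp_wedge_Sm b : Prop :=
  [/\ bilinear_form b, skew_form b, isotropic Sp b & isotropic Sm b].

End Forms.

Section Equivariance.
Variables (R : realType) (n : nat) (S : lmodType R).
Variable rho : 'rV[R]_n -> S -> S.
Implicit Type f : 'rV[R]_n -> S -> S -> R.

(* The matrix X stands for the endomorphism v |-> v *m X. *)
Definition in_so (X : 'M[R]_n) : Prop :=
  forall u v, dotneg (u *m X) v + dotneg u (v *m X) = 0.

(* The image of X under so(V) = spin(V) ⊂ C\ell(V), followed by rho.  With
   ε_i the standard basis, so that ε_i^2 = 1 in C\ell(V), the element of
   spin(V) whose commutator with every v is X v is
   1/4 \sum_i (X ε_i) ε_i. *)
Definition spin_act (X : 'M[R]_n) (s : S) : S :=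
  4^-1 *: \sum_(i < n) rho (delta_mx 0 i *m X) (rho (delta_mx 0 i) s).

Definition spin_scalar_product (h : S -> S -> R) : Prop :=
  [/\ bilinear_form h, symmetric_form h, pos_def_form h
    & forall v, dotneg v v = -1 ->
        forall s t, h (rho v s) (rho v t) = h s t].

Definition j_rho (b : S -> S -> R) : 'rV[R]_n -> S -> S -> R :=
  fun v s t => b (rho v s) t.

Definition equivariant f : Prop :=
  forall X, in_so X -> forall v s t,
    f (v *m X) s t = - f v (spin_act X s) t - f v s (spin_act X t).

Definition equivariant_embedding f : Prop :=
  [/\ forall s t, scalar (fun v => f v s t),
      forall v, bilinear_form (f v),
      forall u v, f u =2 f v -> u = v
    & equivariant f].

Definition embeds_in f (P : (S -> S -> R) -> Prop) : Prop :=
  equivariant_embedding f /\ forall v, P (f v).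

Definition linear_combination (fs : seq ('rV[R]_n -> S -> S -> R)) f : Prop :=
  exists c : 'I_(size fs) -> R, forall v s t,
    f v s t = \sum_(i < size fs) c i * nth (fun _ _ _ => 0) fs i v s t.

End Equivariance.

(* Main.v *)
Require Import Defs.
From HB Require Import structures.
From mathcomp Require Import all_boot all_order all_algebra.
From mathcomp Require Import complex reals ring lra.
Set Implicit Arguments.
Unset Strict Implicit.
Unset Printing Implicit Defensive.
Import Order.TTheory GRing.Theory Num.Theory.
Local Open Scope ring_scope.

(** An equivariant embedding [f] is a family of forms [f v s t = h (F_v s) t]
    with [F] an equivariant map from vectors to operators on [S].  If [n = 2m]
    is the dimension of the space of vectors, such maps are, up to operators
    that commute with Clifford multiplication, the map [rho] itself and its
    product with the volume element, which anticommutes with vectors as [n] is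
    even: these are the only copies of the vector representation in the
    Clifford algebra.  This is proved directly in
    [equivariant_embedding_factor]: the infinitesimal rotations of the
    coordinate planes that contain one fixed basis vector already force
    [F_v = (A + D) \o rho v], where [A] commutes and [D] anticommutes with
    Clifford multiplication.

    Each model has an operator [T] ([E] or [J]) that is invertible and
    anticommutes with Clifford multiplication, so that [D \o T] commutes with
    it as well, and everything reduces to the commutant of [rho].  That is
    computed by comparing coefficients with respect to blades: it is [R] for
    [m] congruent to 0 or 1 ([rho0_commutant], [rho1_commutant]), and the
    quaternion algebra generated by [I] and [s |-> c(s) omega] for [m]
    congruent to 2 or 3 ([rho23_commutant]); the latter operator is [J] or
    [E \o J] according to the parity of [m].

    The type of [j_A] is decided by three signs of [A]: whether it commutes or
    anticommutes with Clifford multiplication, whether it is symmetric or skew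
    for [h], and whether it is even or odd for the grading
    ([embeds_in_vee], [embeds_in_wedge], [embeds_in_wedge2],
    [embeds_in_vee2]).  The second sign is computed for the explicit scalar
    product that makes the blades orthonormal, which is proportional to [h]
    because the commutant consists of scalars plus skew operators
    ([spin_scalar_product_unique]). *)

(** * Linear maps and bilinear forms *)

Section LinearMaps.
Variables (R : pzRingType) (U V : lmodType R) (f : U -> V).
Hypothesis f_lin : linear f.
Let F : {linear U -> V} := HB.pack f (GRing.isLinear.Build R U V *:%R f f_lin).

Lemma lin0 : f 0 = 0. Proof. exact: (linear0 F). Qed.
Lemma linD x y : f (x + y) = f x + f y. Proof. exact: (linearD F). Qed.
Lemma linB x y : f (x - y) = f x - f y. Proof. exact: (linearB F). Qed.
Lemma linN x : f (- x) = - f x. Proof. exact: (linearN F). Qed.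
Lemma linZ a x : f (a *: x) = a *: f x. Proof. exact: (linearZ_LR F). Qed.
Lemma lin_sum I (r : seq I) P (E : I -> U) :
  f (\sum_(i <- r | P i) E i) = \sum_(i <- r | P i) f (E i).
Proof. exact: (linear_sum F). Qed.
End LinearMaps.

Section ScalarMaps.
Variables (R : pzRingType) (U : lmodType R) (f : U -> R).
Hypothesis f_lin : scalar f.
Let F : {scalar U} := HB.pack f (GRing.isLinear.Build R U R *%R f f_lin).

Lemma scal0 : f 0 = 0. Proof. exact: (linear0 F). Qed.
Lemma scalD x y : f (x + y) = f x + f y. Proof. exact: (linearD F). Qed.
Lemma scalN x : f (- x) = - f x. Proof. exact: (linearN F). Qed.
Lemma scalZ a x : f (a *: x) = a * f x.
Proof. by rewrite -[a *: x]addr0 f_lin scal0 addr0. Qed.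
Lemma scal_sum I (r : seq I) P (E : I -> U) :
  f (\sum_(i <- r | P i) E i) = \sum_(i <- r | P i) f (E i).
Proof. exact: (linear_sum F). Qed.
End ScalarMaps.

Section BilinearForms.
Variables (R : realType) (S : lmodType R) (b : S -> S -> R).
Hypothesis b_bil : bilinear_form b.

Lemma bilDl s s' t : b (s + s') t = b s t + b s' t.
Proof. exact: (scalD (b_bil.1 t)). Qed.
Lemma bilNl s t : b (- s) t = - b s t. Proof. exact: (scalN (b_bil.1 t)). Qed.
Lemma bilZl a s t : b (a *: s) t = a * b s t.
Proof. exact: (scalZ (b_bil.1 t)). Qed.
Lemma bil_suml I (r : seq I) P (E : I -> S) t :
  b (\sum_(i <- r | P i) E i) t = \sum_(i <- r | P i) b (E i) t.
Proof. exact: (scal_sum (b_bil.1 t)). Qed.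
Lemma bilDr s t t' : b s (t + t') = b s t + b s t'.
Proof. exact: (scalD (b_bil.2 s)). Qed.
Lemma bilNr s t : b s (- t) = - b s t. Proof. exact: (scalN (b_bil.2 s)). Qed.
Lemma bilZr a s t : b s (a *: t) = a * b s t.
Proof. exact: (scalZ (b_bil.2 s)). Qed.
Lemma bil_sumr I (r : seq I) P (E : I -> S) s :
  b s (\sum_(i <- r | P i) E i) = \sum_(i <- r | P i) b s (E i).
Proof. exact: (scal_sum (b_bil.2 s)). Qed.

Lemma pos_def_nondeg (b_pos : pos_def_form b) s t : b s =1 b t -> s = t.
Proof.
move=> st; apply/eqP; rewrite -subr_eq0; apply/negPn/negP=> /b_pos.
by rewrite bilDl bilNl st subrr ltxx.
Qed.
End BilinearForms.

(** The values of a form on combinations of four terms, in the shape in which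
    [rho23_commutant] describes operators; the second version has the signs
    that appear when [m] is odd. *)
Lemma bil_comb4 (R : realType) (S : lmodType R) (b : S -> S -> R) :
  bilinear_form b -> forall (p1 p2 p3 p4 : R) (s1 s2 s3 s4 t : S),
  b (p1 *: s1 + (p2 *: s2 + p3 *: s3 + p4 *: s4)) t
    = p1 * b s1 t + p2 * b s2 t + p3 * b s3 t + p4 * b s4 t.
Proof.
move=> b_bil p1 p2 p3 p4 s1 s2 s3 s4 t.
by rewrite !(bilDl b_bil) !(bilZl b_bil) !addrA.
Qed.

Lemma bil_comb4N (R : realType) (S : lmodType R) (b : S -> S -> R) :
  bilinear_form b -> forall (p1 p2 p3 p4 : R) (s1 s2 s3 s4 t : S),
  b (p1 *: s1 + (p2 *: s2 + p3 *: - s3 + p4 *: - s4)) t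
    = p1 * b s1 t + p2 * b s2 t + - p3 * b s3 t + - p4 * b s4 t.
Proof.
by move=> b_bil *; rewrite (bil_comb4 b_bil) !(bilNl b_bil) !mulrN !mulNr.
Qed.

(** * Clifford modules and invariant scalar products *)

(** A module over the Clifford algebra of [rV[R]_n] with the form [dotneg],
    given by Clifford multiplication by vectors. *)
Definition clifford_module (R : realType) (n : nat) (S : lmodType R)
    (rho : 'rV[R]_n -> S -> S) : Prop :=
  [/\ forall s, linear (rho^~ s), forall v, linear (rho v)
    & forall v s, rho v (rho v s) = - dotneg v v *: s].

(** Every bilinear form is [h (B _) _] for some linear [B]; this is what finite
    dimension of [S] and nondegeneracy of [h] are needed for. *)
Definition represents_forms (R : realType) (S : lmodType R)
    (h : S -> S -> R) : Prop :=
  forall b, bilinear_form b ->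
    exists2 B, linear B & forall s t, b s t = h (B s) t.

Section CliffordModules.
Variables (R : realType) (n : nat) (S : lmodType R).
Variable rho : 'rV[R]_n -> S -> S.
Hypothesis rho_mod : clifford_module rho.
Implicit Types (u v : 'rV[R]_n) (s t : S) (X : 'M[R]_n).

Let eps (i : 'I_n) : 'rV[R]_n := delta_mx 0 i.
Let rhoL v : linear (rho v). Proof. by case: rho_mod. Qed.
Let rhoV s : linear (rho^~ s). Proof. by case: rho_mod. Qed.

Lemma dotnegC u v : dotneg u v = dotneg v u.
Proof. by congr (- _); apply: eq_bigr => i _; rewrite mulrC. Qed.

Lemma dotneg_bilinear : bilinear_form (@dotneg R n).
Proof.
have H w : scalar (fun u => @dotneg R n u w).
  move=> a u v; rewrite /dotneg mulrN -opprD mulr_sumr -big_split; congr (- _).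
  by apply: eq_bigr => i _; rewrite !mxE mulrDl mulrA.
by split=> // w a u v; rewrite dotnegC (H w a u v) !(dotnegC _ w).
Qed.

Lemma dotneg_delta i v : dotneg (eps i) v = - v 0 i.
Proof.
rewrite /dotneg (bigD1 i) //= big1 => [|j ji].
  by rewrite mxE !eqxx mul1r addr0.
by rewrite mxE (negPf ji) andbF mul0r.
Qed.

Lemma dotneg_eq0 v : dotneg v v = 0 -> v = 0.
Proof.
move/eqP; rewrite oppr_eq0 psumr_eq0 => [/allP v0|i _]; last exact: sqr_ge0.
apply/rowP=> i; rewrite mxE; apply/eqP.
by rewrite -[_ == 0]orbb -mulf_eq0; apply: v0; rewrite mem_index_enum.
Qed.

Lemma rho_expand v s : rho v s = \sum_i v 0 i *: rho (eps i) s.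
Proof.
rewrite {1}[v]row_sum_delta (lin_sum (rhoV s)).
by apply: eq_bigr => i _; rewrite (linZ (rhoV s)).
Qed.

Lemma rho_anti u v s :
  rho u (rho v s) + rho v (rho u s) = - (2 * dotneg u v) *: s.
Proof.
have [_ _ sq] := rho_mod.
have := sq (u + v) s.
rewrite (linD (rhoV s)) (linD (rhoV _)) !(linD (rhoL _)) !sq.
have -> : - dotneg (u + v) (u + v)
    = - dotneg u u + - dotneg v v + - (2 * dotneg u v).
  rewrite !(bilDl dotneg_bilinear, bilDr dotneg_bilinear) (dotnegC v u).
  by ring.
rewrite 2!scalerDl => e; apply: (addrI (- dotneg u u *: s + - dotneg v v *: s)).
by rewrite -[RHS]e addrACA [X in _ + X = _]addrC.
Qed.

Lemma rho_epsK i : involutive (rho (eps i)).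
Proof.
move=> s; have [_ _ sq] := rho_mod.
by rewrite sq dotneg_delta mxE !eqxx opprK scale1r.
Qed.

Lemma rho_eps_anti i j s : i != j ->
  rho (eps i) (rho (eps j) s) = - rho (eps j) (rho (eps i) s).
Proof.
move=> ij; apply/eqP; rewrite -addr_eq0 rho_anti dotneg_delta mxE (negPf ij).
by rewrite andbF oppr0 mulr0 oppr0 scale0r.
Qed.

(** [spin_act X] implements the infinitesimal rotation [X] on vectors:
    the commutator of [spin_act X] with [rho v] is [rho (v *m X)]. *)
Lemma spin_act_rho X v s : in_so X ->
  spin_act rho X (rho v s) = rho v (spin_act rho X s) + rho (v *m X) s.
Proof.
move=> soX.
have term i : rho (eps i *m X) (rho (eps i) (rho v s))
    = rho v (rho (eps i *m X) (rho (eps i) s))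
      + (2 *: ((v *m X) 0 i *: rho (eps i) s)
         + 2 *: (v 0 i *: rho (eps i *m X) s)).
  have swap u w t :
      rho u (rho w t) = - rho w (rho u t) + - (2 * dotneg u w) *: t.
    by rewrite -rho_anti addrCA addNr addr0.
  rewrite (swap (eps i)) (linD (rhoL _)) (linN (rhoL _)) (linZ (rhoL _)).
  rewrite swap opprD opprK -scaleNr opprK dotneg_delta -addrA.
  congr (_ + (_ + _)); rewrite scalerA; congr (_ *: _); last by ring.
  have := soX (eps i) v; rewrite dotneg_delta.
  by move/eqP; rewrite subr_eq0 => /eqP ->.
rewrite /spin_act; under eq_bigr do rewrite term.
rewrite !big_split /= scalerDr (linZ (rhoL _)) (lin_sum (rhoL _)).
congr (_ + _); rewrite -!scaler_sumr -rho_expand.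
have -> : \sum_i v 0 i *: rho (eps i *m X) s = rho (v *m X) s.
  rewrite {2}[v]row_sum_delta mulmx_suml (lin_sum (rhoV s)).
  by apply: eq_bigr => i _; rewrite -scalemxAl (linZ (rhoV s)).
rewrite -scalerDr -mulr2n -scaler_nat !scalerA.
by rewrite -[RHS]scale1r; congr (_ *: _); field.
Qed.

Lemma invariant_rho_sym h v s t : bilinear_form h ->
  (forall v, dotneg v v = -1 -> forall s t, h (rho v s) (rho v t) = h s t) ->
  h (rho v s) t = h s (rho v t).
Proof.
move=> h_bil h_inv.
rewrite !(rho_expand v) (bil_suml h_bil) (bil_sumr h_bil).
apply: eq_bigr => i _; rewrite (bilZl h_bil) (bilZr h_bil); congr (_ * _).
by rewrite -{1}[t](rho_epsK i) h_inv // dotneg_delta mxE !eqxx.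
Qed.

Section ScalarProduct.
Variable h : S -> S -> R.
Hypothesis h_spin : spin_scalar_product rho h.

Let h_bil : bilinear_form h. Proof. by case: h_spin. Qed.
Let h_sym : Defs.symmetric_form h. Proof. by case: h_spin. Qed.
Let h_pos : pos_def_form h. Proof. by case: h_spin. Qed.
Let h_inv v : dotneg v v = -1 -> forall s t, h (rho v s) (rho v t) = h s t.
Proof. by case: h_spin => _ _ _; apply. Qed.
Let h_inj s t : h s =1 h t -> s = t. Proof. exact: pos_def_nondeg. Qed.

Lemma rho_sym v s t : h (rho v s) t = h s (rho v t).
Proof. exact: invariant_rho_sym. Qed.

Lemma spin_act_skew X s t : in_so X ->
  h (spin_act rho X s) t = - h s (spin_act rho X t).
Proof.
move=> soX; rewrite (bilZl h_bil) (bilZr h_bil) -mulrN; congr (_ * _).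
rewrite (bil_suml h_bil) (bil_sumr h_bil) -sumrN; apply: eq_bigr => i _.
rewrite !rho_sym; apply/eqP; rewrite -addr_eq0 -(bilDr h_bil) rho_anti.
have /eqP := soX (eps i) (eps i).
rewrite dotnegC -mulr2n mulrn_eq0 /= => /eqP ->.
by rewrite mulr0 oppr0 scale0r -(scale0r 0) (bilZr h_bil) mul0r.
Qed.

(** [A] commutes ([a = false]) or anticommutes ([a = true]) with Clifford
    multiplication.  Signs are recorded by booleans, so that they compose by
    exclusive or. *)
Definition commutes_up_to (a : bool) (A : S -> S) : Prop :=
  forall v s, A (rho v s) = (-1) ^+ a *: rho v (A s).

(** [A] is symmetric ([c = false]) or skew ([c = true]) for [h]. *)
Definition adjoint_up_to (c : bool) (A : S -> S) : Prop :=
  forall s t, h (A s) t = (-1) ^+ c * h s (A t).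

Lemma signed_spin_act a A X s : linear A -> commutes_up_to a A ->
  A (spin_act rho X s) = spin_act rho X (A s).
Proof.
move=> Al Ac; rewrite /spin_act (linZ Al) (lin_sum Al); congr (_ *: _).
apply: eq_bigr => i _; rewrite !Ac (linZ (rhoL _)) scalerA.
by rewrite -expr2 sqrr_sign scale1r.
Qed.

(** Equivariance holds as [A] commutes with the products of two vectors, hence
    with [spin_act], and as [spin_act] is skew for [h]. *)
Lemma j_rho_embedding a A : (exists s : S, s != 0) ->
  linear A -> injective A -> commutes_up_to a A ->
  equivariant_embedding rho (j_rho rho (form_op h A)).
Proof.
move=> [s0 s0_neq0] Al Ainj Ac; split=> [s t c u v|v|u v uv|X soX v s t].
- by rewrite /j_rho /form_op rhoV Al (bilDl h_bil) (bilZl h_bil).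
- split=> [t c u w|t c u w]; rewrite /j_rho /form_op ?rhoL ?Al.
    by rewrite (bilDl h_bil) (bilZl h_bil).
  by rewrite (bilDr h_bil) (bilZr h_bil).
- apply/eqP; rewrite -subr_eq0; apply/eqP/dotneg_eq0.
  have e s : rho (u - v) s = 0.
    rewrite (linB (rhoV s)); apply/eqP; rewrite subr_eq0; apply/eqP/Ainj/h_inj.
    by move=> t; apply: uv.
  have [_ _ sq] := rho_mod; have /eqP := sq (u - v) s0.
  rewrite e eq_sym scaler_eq0 (negPf s0_neq0) orbF oppr_eq0.
  by move/eqP.
- rewrite /j_rho /form_op.
  have -> : rho (v *m X) s
      = spin_act rho X (rho v s) - rho v (spin_act rho X s).
    by rewrite spin_act_rho // addrC addKr.
  rewrite (linB Al) (signed_spin_act _ _ Al Ac) (bilDl h_bil) (bilNl h_bil).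
  by rewrite spin_act_skew // addrC.
Qed.

(** Equivariance under the infinitesimal rotation that sends [eps k] to [eps j]
    and [eps j] to [- eps k], which acts on [S] by one half of
    [rho (eps j) \o rho (eps k)]. *)
Lemma rotation f j k s t : equivariant_embedding rho f -> j != k ->
  f (eps j) s t = - 2^-1 * (f (eps k) (rho (eps j) (rho (eps k) s)) t
                         + f (eps k) s (rho (eps j) (rho (eps k) t))).
Proof.
move=> [_ f_bil _ f_eq] jk.
pose X : 'M[R]_n := delta_mx k j - delta_mx j k.
have epsX i : eps i *m X = (i == k)%:R *: eps j - (i == j)%:R *: eps k.
  rewrite mulmxBr; congr (_ - _).
    by rewrite mul_delta_mx_cond scaler_nat.
  by rewrite mul_delta_mx_cond scaler_nat.
have soX : in_so X.
  have skew u v : dotneg (u *m X) v = v 0 k * u 0 j - v 0 j * u 0 k.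
    rewrite {1}[u]row_sum_delta mulmx_suml (bil_suml dotneg_bilinear).
    under eq_bigr => i _.
      rewrite -scalemxAl (bilZl dotneg_bilinear) epsX.
      rewrite (bilDl dotneg_bilinear) (bilNl dotneg_bilinear).
      rewrite !(bilZl dotneg_bilinear) !dotneg_delta mulrBr.
      over.
    rewrite sumrB (bigD1 k) //= [X in _ + X - _]big1; last first.
      by move=> i /negPf ->; rewrite mul0r mulr0.
    rewrite [X in _ - X](bigD1 j) //= [X in _ - (_ + X)]big1; last first.
      by move=> i /negPf ->; rewrite mul0r mulr0.
    by rewrite !eqxx !mul1r; ring.
  by move=> u v; rewrite skew dotnegC skew; ring.
have actX w : spin_act rho X w = 2^-1 *: rho (eps j) (rho (eps k) w).
  rewrite /spin_act (bigD1 k) //= (bigD1 j) //= big1 => [|i /andP[ik ij]].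
    rewrite -!/(eps _) !epsX !eqxx (eq_sym k) (negPf jk) !scale0r !scale1r.
    rewrite subr0 sub0r (linN (rhoV _)) addr0 (rho_eps_anti _ jk) -mulr2n.
    by rewrite -scaler_nat scalerA; congr (_ *: _); field.
  rewrite -/(eps i) epsX (negPf ik) (negPf ij) !scale0r subr0.
  by rewrite (lin0 (rhoV _)).
have := f_eq X soX (eps k) s t.
rewrite epsX eqxx (eq_sym k) (negPf jk) scale1r scale0r subr0 => ->.
by rewrite !actX (bilZl (f_bil _)) (bilZr (f_bil _)); ring.
Qed.

(** The infinitesimal rotation applied twice sends [eps k] to [- eps k].  As
    [u = rho (eps j) \o rho (eps k)] squares to [-1], this determines
    [f (eps k) (u s) (u t)]. *)
Lemma rotation_square f j k s t : equivariant_embedding rho f -> j != k ->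
  f (eps k) (rho (eps j) (rho (eps k) s)) (rho (eps j) (rho (eps k) t))
    = - f (eps k) s t.
Proof.
move=> ef jk; have kj : k != j by rewrite eq_sym.
have [_ f_bil _ _] := ef.
have usq w : rho (eps j) (rho (eps k) (rho (eps j) (rho (eps k) w))) = - w.
  by rewrite (rho_eps_anti (rho (eps k) w) kj) (linN (rhoL _)) !rho_epsK.
have := rotation s t ef kj.
rewrite !(rho_eps_anti _ kj) (bilNl (f_bil _)) (bilNr (f_bil _)).
rewrite !(rotation _ _ ef jk) !usq (bilNl (f_bil _)) (bilNr (f_bil _)).
by lra.
Qed.

(** The classification.  Write [f (eps k) s t = h (F s) t] for one fixed [k].
    The rotations in the planes of [eps k] and [eps j] show that
    [f v s t = h (rho v (M s)) t] for all [v], where [M = rho (eps k) \o F],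
    and that the conjugate of [M] by [rho (eps j)] is an operator [N] that does
    not depend on [j].  Therefore [M + N] commutes and [M - N] anticommutes
    with Clifford multiplication. *)
Lemma equivariant_embedding_factor f : represents_forms h -> (0 < n)%N ->
  equivariant_embedding rho f ->
  exists A D : S -> S, [/\ linear A /\ linear D, commutes_up_to false A,
    commutes_up_to true D
    & forall v s t, f v s t = h (A (rho v s)) t + h (D (rho v s)) t].
Proof.
move=> h_rep n_gt0 ef; pose k := Ordinal n_gt0.
have [f_lin f_bil _ _] := ef.
have [F Fl fF] := h_rep _ (f_bil (eps k)).
have Ff j s : j != k ->
    F (rho (eps j) (rho (eps k) s)) = - rho (eps j) (rho (eps k) (F s)).
  move=> jk; have kj : k != j by rewrite eq_sym.
  have e : rho (eps k) (rho (eps j) (F (rho (eps j) (rho (eps k) s)))) = - F s.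
    apply: h_inj => t; rewrite !rho_sym (bilNl h_bil) -!fF.
    exact: rotation_square.
  by rewrite -2!(linN (rhoL _)) -e !rho_epsK.
pose M s := rho (eps k) (F s); pose N s := F (rho (eps k) s).
have MN j s : rho (eps j) (M (rho (eps j) s)) = N s.
  rewrite /M /N; have [->|jk] := eqVneq j k; first by rewrite rho_epsK.
  have kj : k != j by rewrite eq_sym.
  rewrite -{1}[s](rho_epsK k) Ff // 2!(linN (rhoL _)).
  by rewrite (rho_eps_anti _ jk) opprK (rho_epsK j) rho_epsK.
have MrN j s : M (rho (eps j) s) = rho (eps j) (N s).
  by rewrite -(MN j s) rho_epsK.
have NrM j s : N (rho (eps j) s) = rho (eps j) (M s).
  by rewrite -(MN j) rho_epsK.
have Ml : linear M by move=> a s t; rewrite /M Fl rhoL.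
have Nl : linear N by move=> a s t; rewrite /N rhoL Fl.
pose A s := 2^-1 *: (M s + N s); pose D s := 2^-1 *: (N s - M s).
have Al : linear A.
  move=> a s t; rewrite /A Ml Nl.
  rewrite addrACA -[a *: M s + _]scalerDr [LHS]scalerDr; congr (_ + _).
  by rewrite !scalerA mulrC.
have Dl : linear D.
  move=> a s t; rewrite /D Ml Nl opprD addrACA -[a *: N s + _]scalerBr.
  by rewrite [LHS]scalerDr; congr (_ + _); rewrite !scalerA mulrC.
have comm_basis (a : bool) B : linear B ->
    (forall j s, B (rho (eps j) s) = (-1) ^+ a *: rho (eps j) (B s)) ->
    commutes_up_to a B.
  move=> Bl Bj v s; rewrite (rho_expand v s) (rho_expand v (B s)) (lin_sum Bl).
  rewrite scaler_sumr; apply: eq_bigr => j _.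
  by rewrite (linZ Bl) Bj !scalerA mulrC.
exists A, D; split=> //.
- apply: comm_basis => // j s; rewrite scale1r /A (linZ (rhoL _)) MrN NrM.
  by rewrite (linD (rhoL _)) addrC.
- apply: comm_basis => // j s; rewrite expr1 scaleN1r /D (linZ (rhoL _)).
  by rewrite MrN NrM -scalerN (linB (rhoL _)) opprB.
move=> v s t; rewrite -(bilDl h_bil).
have AD w : A w + D w = N w.
  rewrite -scalerDr [M w + _]addrC addrACA subrr addr0 -mulr2n -scaler_nat.
  by rewrite scalerA mulVf ?pnatr_eq0 // scale1r.
rewrite AD {1}[v]row_sum_delta (scal_sum (f_lin s t)) rho_expand (lin_sum Nl).
rewrite (bil_suml h_bil); apply: eq_bigr => j _.
rewrite (scalZ (f_lin s t)) (linZ Nl) (bilZl h_bil) NrM; congr (_ * _).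
have [->|jk] := eqVneq j k; first by rewrite /M rho_epsK.
rewrite -/(eps j) (rotation s t ef jk) !fF Ff // (bilNl h_bil).
rewrite -[h (F s) _]rho_sym -[h (rho _ (F s)) _]rho_sym /M.
have kj : k != j by rewrite eq_sym.
by rewrite (rho_eps_anti _ kj) (bilNl h_bil); field.
Qed.

(** If every operator that commutes with Clifford multiplication is a scalar
    plus an [h]-skew operator, then the invariant scalar product is unique up to
    scale: [g = h (P _) _] with [P] symmetric, so that the skew part of [P]
    vanishes. *)
Lemma spin_scalar_product_unique g : spin_scalar_product rho g ->
  represents_forms h -> (exists s : S, s != 0) ->
  (forall P, linear P -> commutes_up_to false P ->
     exists p Q, (forall s, P s = p *: s + Q s) /\ adjoint_up_to true Q) ->
  exists2 p, 0 < p & forall s t, g s t = p * h s t.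
Proof.
move=> [g_bil g_sym g_pos g_inv] h_rep [s0 s0_neq0] comm.
have [P Pl gP] := h_rep _ g_bil.
have Pc : commutes_up_to false P.
  move=> v s; rewrite scale1r; apply: h_inj => t; rewrite rho_sym -!gP.
  exact: invariant_rho_sym.
have [p [Q [PQ Qskew]]] := comm P Pl Pc.
have Q0 s t : h (Q s) t = 0.
  have := g_sym s t; rewrite !gP !PQ !(bilDl h_bil) !(bilZl h_bil) (h_sym s).
  by move/addrI; rewrite (h_sym (Q t)) Qskew mulN1r => e; lra.
have gE s t : g s t = p * h s t.
  by rewrite gP PQ (bilDl h_bil) (bilZl h_bil) Q0 addr0.
exists p => //; have := g_pos _ s0_neq0.
by rewrite gE pmulr_lgt0 // h_pos.
Qed.

(** How the signs of [A] decide the type of the forms [h (A (rho v _)) _].  The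
    boolean [p] says whether [A] is odd for the grading operator [E]. *)
Section DualTypes.
Variables (a c : bool) (A : S -> S).
Hypotheses (S_neq0 : exists s : S, s != 0) (Al : linear A).
Hypotheses (Ainj : injective A) (Ac : commutes_up_to a A).
Hypothesis Aadj : adjoint_up_to c A.
Let j := j_rho rho (form_op h A).

Let j_emb : equivariant_embedding rho j. Proof. exact: j_rho_embedding Ac. Qed.

Let j_sign v s t : j v s t = (-1) ^+ (a (+) c) * j v t s.
Proof.
rewrite /j /j_rho /form_op Aadj rho_sym h_sym [in RHS]Ac (bilZl h_bil).
by rewrite signr_addb; case: a; case: c; rewrite /=; ring.
Qed.

Lemma embeds_in_vee2 : a = c -> embeds_in rho j (@dual_vee2 R S).
Proof.
move=> ac; split=> // v; have [_ f_bil _ _] := j_emb; split=> // s t.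
by rewrite j_sign ac addbb mul1r.
Qed.

Variables (p : bool) (E : S -> S) (Sp Sm : S -> Prop).
Hypotheses (Ec : commutes_up_to true E) (Eadj : adjoint_up_to false E).
Hypothesis EA : forall s, E (A s) = (-1) ^+ p *: A (E s).
Hypothesis SpE : forall s, Sp s -> E s = s.
Hypothesis SmE : forall s, Sm s -> E s = - s.

Let j_grade v s t : j v (E s) t = (-1) ^+ (~~ p) * j v s (E t).
Proof.
have := Eadj (A (rho v s)) t; rewrite /j /j_rho /form_op mul1r => <-.
rewrite EA !Ec scaleN1r (linN Al) scalerN (bilNl h_bil) (bilZl h_bil).
by case: p; rewrite /= ?scaleN1r ?(linN Al) ?(bilNl h_bil); ring.
Qed.

Lemma embeds_in_vee : p = false -> a = c ->
  embeds_in rho j (dual_Sp_vee_Sm Sp Sm).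
Proof.
move=> p0 ac; split=> // v; have [_ f_bil _ _] := j_emb.
split=> // [s t|s t ss st|s t ss st].
- by rewrite j_sign ac addbb mul1r.
- have := j_grade v s t; rewrite p0 !SpE //=; lra.
- have := j_grade v s t; rewrite p0 !SmE // (bilNl (f_bil v)) (bilNr (f_bil v)).
  by rewrite /=; lra.
Qed.

Lemma embeds_in_wedge : p = false -> a = ~~ c ->
  embeds_in rho j (dual_Sp_wedge_Sm Sp Sm).
Proof.
move=> p0 ac; split=> // v; have [_ f_bil _ _] := j_emb.
split=> // [s t|s t ss st|s t ss st].
- by rewrite j_sign ac addNb addbb mulN1r.
- have := j_grade v s t; rewrite p0 !SpE //=; lra.
- have := j_grade v s t; rewrite p0 !SmE // (bilNl (f_bil v)) (bilNr (f_bil v)).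
  by rewrite /=; lra.
Qed.

Lemma embeds_in_wedge2 : p = true -> a = ~~ c ->
  embeds_in rho j (dual_wedge2_sum Sp Sm).
Proof.
move=> p1 ac; split=> // v; have [_ f_bil _ _] := j_emb.
split=> // [s t|s t ss st].
- by rewrite j_sign ac addNb addbb mulN1r.
- have := j_grade v s t; rewrite p1 SpE // SmE // (bilNr (f_bil v)) /=; lra.
Qed.

End DualTypes.
End ScalarProduct.
End CliffordModules.

(** * Blades of the Clifford algebra *)

Lemma odd_sum (I : finType) (F : I -> nat) :
  odd (\sum_i F i) = \big[addb/false]_i odd (F i).
Proof. exact: (big_morph odd oddD). Qed.

Lemma odd_card (T : finType) (A : {set T}) :
  odd #|A| = \big[addb/false]_i (i \in A).
Proof.
rewrite -sum1_card big_mkcond odd_sum; apply: eq_bigr => i _.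
by case: (i \in A).
Qed.

Lemma odd_card_symdiff (T : finType) (A B : {set T}) :
  odd #|symdiff A B| = odd #|A| (+) odd #|B|.
Proof. by rewrite !odd_card -big_split; apply: eq_bigr => i _; rewrite inE. Qed.

Section CliffordBlades.
Variables (K : comNzRingType) (m : nat).
Implicit Types (x y : cl K m) (A B C : {set 'I_m}).

Lemma symdiff_id A : symdiff A A = set0.
Proof. by apply/eqP; rewrite symdiff_eq0. Qed.

Lemma symdiffKr A B : symdiff (symdiff A B) B = A.
Proof. by rewrite symdiffC (symdiffC A) symdiffK. Qed.

Lemma blade_mulE B x C :
  (blade K B * x) C = (-1) ^+ cl_inv B (symdiff B C) * x (symdiff B C).
Proof.
rewrite ffunE (bigD1 B) //= big1 => [|D /negPf nD].
  by rewrite ffunE eqxx mul1r addr0.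
by rewrite ffunE nD mul0r mulr0.
Qed.

Lemma mul_bladeE B x C :
  (x * blade K B) C = (-1) ^+ cl_inv (symdiff B C) B * x (symdiff B C).
Proof.
rewrite ffunE (bigD1 (symdiff B C)) //= big1 => [|D nD].
  by rewrite symdiffKr ffunE eqxx mulr1 addr0.
rewrite ffunE; case: eqP => [e|]; last by rewrite !mulr0.
by rewrite -e symdiffKr eqxx in nD.
Qed.

Lemma cl_inv1l i C : cl_inv [set i] C = \big[addb/false]_(j in C) (j < i)%N.
Proof.
rewrite /cl_inv (bigD1 i) //= [X in _ (+) X]big1 => [|k /negPf nk]; last first.
  by rewrite big1 // => l _; rewrite inE nk.
rewrite addbF [RHS]big_mkcond; apply: eq_bigr => j _; rewrite inE eqxx /=.
by case: (j \in C).
Qed.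

Lemma cl_inv1r i C : cl_inv C [set i] = \big[addb/false]_(j in C) (i < j)%N.
Proof.
rewrite /cl_inv [RHS]big_mkcond; apply: eq_bigr => j _.
rewrite (bigD1 i) //= [X in _ (+) X]big1 => [|k /negPf nk]; last first.
  by rewrite inE nk andbF.
by rewrite inE eqxx addbF; case: (j \in C).
Qed.

(** [e_i] and [e_C] commute up to the sign [(-1) ^ (#|C| - [i in C])]. *)
Lemma cl_inv1C i C :
  cl_inv [set i] C (+) cl_inv C [set i] = odd #|C| (+) (i \in C).
Proof.
rewrite cl_inv1l cl_inv1r -big_split odd_card big_mkcond /=.
rewrite (bigD1 i) //= [in RHS](bigD1 i) //= ltnn [RHS]addbAC [in RHS]addbb.
have -> : (if i \in C then false (+) false else false) = false by case: ifP.
congr (_ (+) _); apply: eq_bigr => j; rewrite -(inj_eq val_inj) /=.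
by case: (j \in C); case: ltngtP.
Qed.

Lemma cl_expand x : x = \sum_A x A *: blade K A.
Proof.
apply/ffunP=> B; rewrite sum_ffunE (bigD1 B) //= big1 => [|A nA].
  by rewrite !ffunE eqxx mulr1 addr0.
by rewrite !ffunE eq_sym (negPf nA) mulr0.
Qed.

Lemma cl_vec_linear : linear (@cl_vec K m).
Proof.
move=> a u v; rewrite /cl_vec scaler_sumr -big_split; apply: eq_bigr => i _.
by rewrite !mxE scalerDl scalerA.
Qed.

Lemma cl_vec_delta (i : 'I_m) : cl_vec (delta_mx 0 i) = cl_gen K i.
Proof.
rewrite /cl_vec (bigD1 i) //= big1 => [|j /negPf ji]; rewrite mxE ?eqxx.
  by rewrite scale1r addr0.
by rewrite ji andbF scale0r.
Qed.

Lemma cl_alpha_linear : linear (@cl_alpha K m).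
Proof.
by move=> a x y; apply/ffunP=> A; rewrite !ffunE mulrDr mulrCA.
Qed.

Lemma sign_card A : (-1) ^+ #|A| = (-1) ^+ odd #|A| :> K.
Proof. by rewrite signr_odd. Qed.

Lemma cl_alphaM x y : cl_alpha (x * y) = cl_alpha x * cl_alpha y.
Proof.
apply/ffunP=> C; rewrite !ffunE mulr_sumr; apply: eq_bigr => A _.
rewrite !ffunE !sign_card odd_card_symdiff signr_addb.
by case: (odd #|A|); case: (odd #|C|); rewrite ?expr0 ?expr1; ring.
Qed.

Lemma cl_alphaK : involutive (@cl_alpha K m).
Proof.
by move=> x; apply/ffunP=> A; rewrite !ffunE mulrA -expr2 sqrr_sign mul1r.
Qed.

Lemma cl_alpha_blade A : cl_alpha (blade K A) = (-1) ^+ #|A| *: blade K A.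
Proof.
apply/ffunP=> B; rewrite !ffunE; case: eqP => [->|] //.
by rewrite !mulr0.
Qed.

Lemma cl_alpha_vec u : cl_alpha (cl_vec u) = - cl_vec u :> cl K m.
Proof.
rewrite /cl_vec (lin_sum cl_alpha_linear) -sumrN; apply: eq_bigr => i _.
by rewrite (linZ cl_alpha_linear) cl_alpha_blade cards1 expr1 scaleN1r scalerN.
Qed.

Lemma cl_evenE x : cl_even x -> cl_alpha x = x.
Proof.
move=> xe; apply/ffunP=> A; rewrite ffunE sign_card.
by case Ao: (odd #|A|); rewrite ?mul1r // xe ?mulr0.
Qed.

Lemma cl_oddE x : cl_odd x -> cl_alpha x = - x.
Proof.
move=> xo; apply/ffunP=> A; rewrite !ffunE sign_card.
by case Ao: (odd #|A|); rewrite ?mulN1r // xo ?Ao // mulr0 oppr0.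
Qed.

(** This twisted conjugation by [e_i] is diagonal on blades; all commutants are
    computed from it. *)
Lemma gen_alpha_gen i x B :
  (cl_gen K i * cl_alpha x * cl_gen K i) B = (-1) ^+ (i \in B) * x B.
Proof.
rewrite mul_bladeE blade_mulE symdiffK ffunE !mulrA sign_card.
rewrite -!signr_addb; congr ((-1) ^+ nat_of_bool _ * _).
have -> : cl_inv (symdiff [set i] B) [set i] = cl_inv B [set i].
  by rewrite cl_invDl cl_inv1 ltnn.
have := cl_inv1C i B.
by do 2 case: (cl_inv _ _); case: (odd _); case: (i \in B).
Qed.

Lemma cl_omegaE : cl_omega K m = blade K setT.
Proof.
have prodE (s : seq 'I_m) : sorted ltn (map val s) ->
    \prod_(i <- s) cl_gen K i = blade K [set i in s].
  elim: s => [_|i s IHs].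
    by rewrite big_nil; congr blade; apply/setP=> i; rewrite !inE.
  rewrite big_cons /= => path_s; rewrite IHs; last exact: path_sorted path_s.
  rewrite bladeM.
  have lt_is j : j \in s -> (i < j)%N.
    by move=> js; apply: (allP (order_path_min ltn_trans path_s)); apply: map_f.
  have -> : cl_inv [set i] [set j in s] = false.
    rewrite cl_inv1l big1 // => j; rewrite inE => /lt_is.
    by case: ltngtP.
  rewrite scale1r; congr blade; apply/setP=> j; rewrite !inE.
  by case: eqP => [->|] //=; case: (boolP (i \in s)) => // /lt_is; rewrite ltnn.
have -> : cl_omega K m = \prod_(i <- enum 'I_m) cl_gen K i.
  by rewrite /cl_omega [index_enum _]unlock enumT.
rewrite prodE.
  by congr blade; apply/setP=> i; rewrite !inE mem_enum.
by rewrite val_enum_ord iota_ltn_sorted.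
Qed.

Lemma cl_alpha_omega : cl_alpha (cl_omega K m) = (-1) ^+ odd m *: cl_omega K m.
Proof. by rewrite cl_omegaE cl_alpha_blade cardsT card_ord signr_odd. Qed.

Lemma cl_inv_setT : cl_inv [set: 'I_m] setT = odd 'C(m, 2).
Proof.
rewrite -[in RHS]bin2_sum big_mkord odd_sum; apply: eq_bigr => i _.
rewrite -[in RHS](card_ord i) -sum1_card odd_sum.
rewrite (big_ord_widen m (fun=> true)) ?(ltnW (ltn_ord i)) // [RHS]big_mkcond.
by apply: eq_bigr => j _; rewrite !inE; case: ltnP.
Qed.

Lemma cl_omega_sqr : cl_omega K m * cl_omega K m = (-1) ^+ odd 'C(m, 2) *: 1.
Proof. by rewrite cl_omegaE bladeM symdiff_id cl_inv_setT. Qed.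

Lemma omega_vec u : (0 < m)%N ->
  cl_omega K m * cl_vec u = (-1) ^+ (~~ odd m) *: (cl_vec u * cl_omega K m).
Proof.
move=> m_gt0; rewrite /cl_vec mulr_sumr mulr_suml scaler_sumr.
apply: eq_bigr => i _; rewrite -scalerAr -scalerAl scalerA mulrC -scalerA.
congr (_ *: _); rewrite cl_omegaE !bladeM scalerA symdiffC; congr (_ *: _).
rewrite -signr_addb; congr ((-1) ^+ nat_of_bool _).
have := cl_inv1C i setT; rewrite cardsT card_ord inE.
by case: (cl_inv _ _); case: (cl_inv _ _); case: (odd m).
Qed.

(** Linear combinations of products of generators exhaust the algebra. *)
Lemma cl_ind (P : cl K m -> Prop) :
  (forall a x y, P x -> P y -> P (a *: x + y)) -> P 1 ->
  (forall i x, P x -> P (cl_gen K i * x)) -> forall x, P x.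
Proof.
move=> PL P1 PM x.
have P0 : P 0 by rewrite -[0](addNr 1) -scaleN1r; apply: PL.
have PA n A : (#|A| <= n)%N -> P (blade K A).
  elim: n A => [|n IHn] A.
    by rewrite leqn0 cards_eq0 => /eqP ->.
  have [->|[i iA]] := set_0Vmem A; first by [].
  rewrite (cardsD1 i) iA ltnS => /IHn /(PM i).
  have Ai : symdiff [set i] (A :\ i) = A.
    by apply/setP=> j; rewrite !inE; case: eqP => [->|] //=; rewrite iA.
  move=> PB; rewrite -Ai -[blade _ _](scale1r _).
  rewrite -(sqrr_sign K (cl_inv [set i] (A :\ i))) expr2 -scalerA -bladeM.
  by rewrite -[_ *: _]addr0; apply: PL.
rewrite (cl_expand x); apply: (big_ind P) => // [y z Py Pz|A _].
  by rewrite -[y]scale1r; apply: PL.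
by rewrite -[_ *: _]addr0; apply: PL => //; apply: PA (leqnn _).
Qed.

End CliffordBlades.

Lemma odd_mod4 m : odd m = odd (m %% 4).
Proof. by rewrite {1}(divn_eq m 4) oddD oddM andbF. Qed.

Lemma odd_bin2_mod4 m : odd 'C(m, 2) = (1 < m %% 4)%N.
Proof.
rewrite {1}(divn_eq m 4); have := ltn_pmod m (isT : (0 < 4)%N).
move: (m %% 4)%N (m %/ 4)%N => r q r4.
elim: q => [|q IHq]; first by case: r r4 => [|[|[|[|]]]].
rewrite mulSn -addnA; move: (_ + r)%N IHq => n <-.
rewrite !addSn add0n 4!binS !bin1 !oddD /=.
by case: (odd 'C(n, 2)); case: (odd n).
Qed.

Section DotProduct.
Variables (R : realType) (m : nat).
Implicit Types (s t : cl R m) (A B : {set 'I_m}) (u v : 'rV[R]_m).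

(** The scalar product for which the blades are orthonormal. *)
Definition cl_dot s t : R := \sum_A s A * t A.

Lemma cl_dotC : Defs.symmetric_form cl_dot.
Proof. by move=> s t; apply: eq_bigr => A _; rewrite mulrC. Qed.

Lemma cl_dot_bilinear : bilinear_form cl_dot.
Proof.
have H t : scalar (cl_dot^~ t).
  move=> a s s'; rewrite /cl_dot mulr_sumr -big_split; apply: eq_bigr => A _.
  by rewrite !ffunE mulrDl mulrA.
by split=> // s a t t'; rewrite cl_dotC (H s a t t') !(cl_dotC _ s).
Qed.

Lemma cl_dot_pos : pos_def_form cl_dot.
Proof.
move=> s s_neq0; rewrite lt_neqAle sumr_ge0 => [|A _]; last exact: sqr_ge0.
rewrite andbT eq_sym psumr_eq0 => [|A _]; last exact: sqr_ge0.
apply: contra s_neq0 => /allP s0; apply/eqP/ffunP=> A; rewrite ffunE.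
apply/eqP; rewrite -[_ == 0]orbb -mulf_eq0; apply: s0.
exact: mem_index_enum.
Qed.

Lemma cl_dot_riesz (phi : cl R m -> R) t : scalar phi ->
  phi t = cl_dot [ffun A => phi (blade R A)] t.
Proof.
move=> phi_lin; rewrite {1}(cl_expand t) (scal_sum phi_lin).
by apply: eq_bigr => A _; rewrite (scalZ phi_lin) ffunE mulrC.
Qed.

Lemma cl_dot_blade_mul B s t :
  cl_dot (blade R B * s) t = (-1) ^+ cl_inv B B * cl_dot s (blade R B * t).
Proof.
rewrite /cl_dot (reindex_inj (inv_inj (symdiffK B))) mulr_sumr /=.
apply: eq_bigr => C _; rewrite !blade_mulE symdiffK cl_invDr signr_addb.
by case: (cl_inv B B); case: (cl_inv _ _); rewrite ?expr0 ?expr1; ring.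
Qed.

Lemma cl_dot_mul_blade B s t :
  cl_dot (s * blade R B) t = (-1) ^+ cl_inv B B * cl_dot s (t * blade R B).
Proof.
rewrite /cl_dot (reindex_inj (inv_inj (symdiffK B))) mulr_sumr /=.
apply: eq_bigr => C _; rewrite !mul_bladeE symdiffK cl_invDl signr_addb.
by case: (cl_inv B B); case: (cl_inv _ _); rewrite ?expr0 ?expr1; ring.
Qed.

Lemma cl_dot_vec_mul u s t : cl_dot (cl_vec u * s) t = cl_dot s (cl_vec u * t).
Proof.
rewrite /cl_vec !mulr_suml (bil_suml cl_dot_bilinear).
rewrite (bil_sumr cl_dot_bilinear).
apply: eq_bigr => i _; rewrite -!scalerAl (bilZl cl_dot_bilinear).
rewrite (bilZr cl_dot_bilinear); congr (_ * _).
by rewrite cl_dot_blade_mul cl_inv1 ltnn mul1r.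
Qed.

Lemma cl_dot_mul_vec u s t : cl_dot (s * cl_vec u) t = cl_dot s (t * cl_vec u).
Proof.
rewrite /cl_vec !mulr_sumr (bil_suml cl_dot_bilinear).
rewrite (bil_sumr cl_dot_bilinear).
apply: eq_bigr => i _; rewrite -!scalerAr (bilZl cl_dot_bilinear).
rewrite (bilZr cl_dot_bilinear); congr (_ * _).
by rewrite cl_dot_mul_blade cl_inv1 ltnn mul1r.
Qed.

Lemma cl_dot_omega s t : cl_dot (cl_omega R m * s) t
  = (-1) ^+ odd 'C(m, 2) * cl_dot s (cl_omega R m * t).
Proof. by rewrite cl_omegaE cl_dot_blade_mul cl_inv_setT. Qed.

Lemma cl_dot_alpha s t : cl_dot (cl_alpha s) t = cl_dot s (cl_alpha t).
Proof. by apply: eq_bigr => A _; rewrite !ffunE; ring. Qed.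

(** The commutant of the left multiplications consists of the right
    multiplications. *)
Lemma left_mul_commutant (A : cl R m -> cl R m) : linear A ->
  (forall u s, A (cl_vec u * s) = cl_vec u * A s) -> forall s, A s = s * A 1.
Proof.
move=> Al Avec; elim/cl_ind=> [a x y Ax Ay||i x Ax].
- by rewrite Al Ax Ay mulrDl scalerAl.
- by rewrite mul1r.
- by rewrite -cl_vec_delta Avec Ax mulrA.
Qed.

Lemma twisted_central (a : cl R m) :
  (forall i, cl_gen R i * cl_alpha a * cl_gen R i = a) -> a = a set0 *: 1.
Proof.
move=> ea; apply/ffunP=> B; rewrite !ffunE.
have [->|[i iB]] := set_0Vmem B; first by rewrite eqxx mulr1.
have := congr1 (fun x : cl R m => x B) (ea i).
rewrite gen_alpha_gen iB mulN1r => e.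
have -> : B == set0 = false by apply/negP=> /eqP B0; rewrite B0 inE in iB.
by rewrite mulr0; lra.
Qed.

(** For even [m] the centre of the Clifford algebra is [R]. *)
Lemma central_even (a : cl R m) : ~~ odd m ->
  (forall i, cl_gen R i * a * cl_gen R i = a) -> a = a set0 *: 1.
Proof.
move=> m_even ea; apply/ffunP=> B; rewrite !ffunE.
have [->|B0] := eqVneq B set0; first by rewrite mulr1.
rewrite mulr0.
have aB i : a B = (-1) ^+ ((i \in B) (+) odd #|B|) * a B.
  have := congr1 (fun x : cl R m => x B) (ea i).
  by rewrite -{1}[a]cl_alphaK gen_alpha_gen ffunE sign_card mulrA -signr_addb.
have [i iB] : exists i, (i \in B) (+) odd #|B|.
  have [oB|eB] := boolP (odd #|B|); last first.
    have [B1|[i iB]] := set_0Vmem B; first by rewrite B1 eqxx in B0.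
    by exists i; rewrite iB.
  have [BT|[i iB]] := set_0Vmem (~: B); last first.
    by exists i; rewrite inE in iB; rewrite (negPf iB).
  by rewrite -(setCK B) BT setC0 cardsT card_ord (negPf m_even) in oB.
by have := aB i; rewrite iB; lra.
Qed.

End DotProduct.

(** * The real models *)

Section Reference.
Variables (R : realType) (n : nat) (S : lmodType R).
Variable rho : 'rV[R]_n -> S -> S.

Lemma symmetric_spin_scalar_product h : clifford_module rho ->
  bilinear_form h -> Defs.symmetric_form h -> pos_def_form h ->
  (forall v s t, h (rho v s) t = h s (rho v t)) -> spin_scalar_product rho h.
Proof.
move=> [_ _ sq] h_bil h_sym h_pos rho_h; split=> // v v1 s t.
by rewrite rho_h sq v1 opprK scale1r.
Qed.

(** Every spin scalar product [h] is a positive multiple of the given one [g],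
    so it also represents all forms and has the same symmetric and skew
    operators. *)
Lemma reference_product g h : clifford_module rho ->
  spin_scalar_product rho g -> represents_forms g -> (exists s : S, s != 0) ->
  (forall P, linear P -> commutes_up_to rho false P ->
     exists p Q, (forall s, P s = p *: s + Q s) /\ adjoint_up_to g true Q) ->
  spin_scalar_product rho h ->
  represents_forms h /\
  forall c A, adjoint_up_to g c A -> adjoint_up_to h c A.
Proof.
move=> rho_mod g_spin g_rep S_neq0 comm h_spin.
have [p p_gt0 hE] :=
  spin_scalar_product_unique rho_mod g_spin h_spin g_rep S_neq0 comm.
have [g_bil _ _ _] := g_spin.
split=> [b /g_rep [B Bl bE]|c A Aadj s t]; last first.
  by rewrite !hE Aadj mulrCA.
exists (fun s => p^-1 *: B s) => [a s t|s t].
  by rewrite Bl scalerDr !scalerA mulrC.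
by rewrite hE bE (bilZl g_bil) mulVKf // gt_eqF.
Qed.
End Reference.

Section RealModels.
Variables (R : realType) (m : nat).
Implicit Types (s t : cl R m) (u v : 'rV[R]_(m + m)).
Local Notation omega := (cl_omega R m).
Local Notation alpha := (@cl_alpha R m).

Lemma dotneg_split v :
  dotneg v v = dotneg (lsubmx v) (lsubmx v) + dotneg (rsubmx v) (rsubmx v).
Proof.
rewrite /dotneg big_split_ord opprD; congr (- _ - _);
  by apply: eq_bigr => i _; rewrite mxE.
Qed.

Lemma cl_vecK (x : 'rV[R]_m) s : cl_vec x * (cl_vec x * s) = - dotneg x x *: s.
Proof. by rewrite mulrA cl_vec_sqr -scalerAl mul1r. Qed.

Lemma cl_vecKr (x : 'rV[R]_m) s : s * cl_vec x * cl_vec x = - dotneg x x *: s.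
Proof. by rewrite -mulrA cl_vec_sqr -scalerAr mulr1. Qed.

Lemma cl_dot_represents : represents_forms (@cl_dot R m).
Proof.
move=> b [b_l b_r]; exists (fun s => [ffun A => b s (blade R A)] : cl R m).
  by move=> a s t; apply/ffunP=> A; rewrite !ffunE b_l.
by move=> s t; apply: cl_dot_riesz.
Qed.

Lemma cl_neq0 : exists s : cl R m, s != 0.
Proof. by exists 1; apply: oner_neq0. Qed.

Lemma cl_vec0 : cl_vec (0 : 'rV[R]_m) = 0.
Proof. exact: lin0 (@cl_vec_linear R m). Qed.

Section Model0.
Hypotheses (m_gt0 : (0 < m)%N) (m_mod : (m %% 4)%N = 0%N).
Local Notation rho := (@rho0 R m).

Let m_even : odd m = false. Proof. by rewrite odd_mod4 m_mod. Qed.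
Let omega_sqr : omega * omega = 1.
Proof. by rewrite cl_omega_sqr odd_bin2_mod4 m_mod scale1r. Qed.
Let omega_anti x : omega * cl_vec x = - (cl_vec x * omega).
Proof. by rewrite omega_vec // m_even scaleN1r. Qed.

Lemma rho0_module : clifford_module rho.
Proof.
split=> [s a u v|v a s t|v s]; rewrite /rho0.
- rewrite !linearP !cl_vec_linear mulrDl mulrDr addrACA -scalerAl -scalerAr.
  by rewrite -scalerDr.
- by rewrite !mulrDr !mulrDl addrACA -!(scalerAr, scalerAl) -scalerDr.
- rewrite !mulrDr mulrDl cl_vecK !mulrA omega_anti omega_sqr mul1r cl_vecKr.
  by rewrite !mulNr addrA addrK dotneg_split opprD scalerDl.
Qed.

Lemma rho0_sym v s t : cl_dot (rho v s) t = cl_dot s (rho v t).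
Proof.
rewrite (bilDl (@cl_dot_bilinear R m)) (bilDr (@cl_dot_bilinear R m)).
rewrite cl_dot_vec_mul -mulrA cl_dot_omega cl_dot_mul_vec.
by rewrite odd_bin2_mod4 m_mod mul1r.
Qed.

Lemma rho0_spin : spin_scalar_product rho (@cl_dot R m).
Proof.
apply: symmetric_spin_scalar_product rho0_sym.
- exact: rho0_module.
- exact: cl_dot_bilinear.
- exact: cl_dotC.
- exact: cl_dot_pos.
Qed.

(** Commuting with left multiplications makes [A] the right multiplication by
    [A 1]; commuting with [s |-> omega * s * x] makes [A 1] central. *)
Lemma rho0_commutant A : linear A -> commutes_up_to rho false A ->
  exists p, forall s, A s = p *: s.
Proof.
move=> Al Ac.
have rhol x s : rho (row_mx x 0) s = cl_vec x * s.
  by rewrite /rho0 row_mxKl row_mxKr cl_vec0 mulr0 addr0.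
have rhor x s : rho (row_mx 0 x) s = omega * s * cl_vec x.
  by rewrite /rho0 row_mxKl row_mxKr cl_vec0 mul0r add0r.
have AE : forall s, A s = s * A 1.
  by apply: left_mul_commutant => // x s; rewrite -!rhol Ac scale1r.
exists (A 1 set0) => s; rewrite {1}AE {1}(@central_even _ _ (A 1)) ?m_even //.
  by rewrite -scalerAr mulr1.
move=> i; have := Ac (row_mx 0 (delta_mx 0 i)) 1.
rewrite scale1r !rhor cl_vec_delta [in LHS]AE mulr1 => e.
have {}e : cl_gen R i * A 1 = A 1 * cl_gen R i.
  by have := congr1 ( *%R omega) e; rewrite /= !mulrA omega_sqr !mul1r.
by rewrite e -mulrA cl_gen_sqr mulr1.
Qed.

Lemma rho0_alpha : commutes_up_to rho true alpha.
Proof.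
move=> v s; rewrite /rho0 (linD (@cl_alpha_linear R m)) !cl_alphaM.
rewrite !cl_alpha_vec cl_alpha_omega m_even scale1r scaleN1r mulNr mulrN.
by rewrite opprD.
Qed.

Lemma rho0_embeddings (h : cl R m -> cl R m -> R) : spin_scalar_product rho h ->
  let j A := j_rho rho (form_op h A) in
    (forall f, equivariant_embedding rho f ->
       linear_combination [:: j_rho rho h; j alpha] f)
    /\ embeds_in rho (j_rho rho h) (dual_Sp_vee_Sm (@cl_even R m) (@cl_odd R m))
    /\ embeds_in rho (j alpha) (dual_Sp_wedge_Sm (@cl_even R m) (@cl_odd R m)).
Proof.
move=> h_spin j.
have comm P : linear P -> commutes_up_to rho false P ->
    exists p Q, (forall s, P s = p *: s + Q s)
                /\ adjoint_up_to (@cl_dot R m) true Q.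
  move=> Pl /(rho0_commutant Pl) [p Pp]; exists p, (fun=> 0); split=> [s|s t].
    by rewrite addr0.
  rewrite -(scale0r 0) (bilZl (@cl_dot_bilinear R m)).
  by rewrite (bilZr (@cl_dot_bilinear R m)); ring.
have [h_rep h_adj] := reference_product rho0_module rho0_spin cl_dot_represents
  cl_neq0 comm h_spin.
have [h_bil _ _ _] := h_spin.
have alpha_adj : adjoint_up_to h false alpha.
  by apply: h_adj => s t; rewrite mul1r cl_dot_alpha.
have alphal := @cl_alpha_linear R m.
split; last split.
- move=> f f_emb.
  have [|A [D [[Al Dl] Ac Dc fE]]] :=
    equivariant_embedding_factor rho0_module h_spin h_rep _ f_emb.
    by rewrite addn_gt0 m_gt0.
  have [p Ap] := rho0_commutant Al Ac.
  (* Both factors anticommute with [rho], so that the product commutes. *)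
  have [||q Dq] := @rho0_commutant (D \o alpha).
  + by move=> a s t; rewrite /= alphal Dl.
  + move=> v s; rewrite /= rho0_alpha scale1r !scaleN1r (linN Dl) Dc.
    by rewrite expr1 scaleN1r opprK.
  exists (fun i => nth 0 [:: p; q] i) => v s t.
  rewrite !big_ord_recl big_ord0 addr0 /= fE Ap (bilZl h_bil); congr (_ + _).
  rewrite -[rho v s in LHS]cl_alphaK -[D _]/((D \o alpha) _) Dq.
  by rewrite (bilZl h_bil).
- apply: (embeds_in_vee rho0_module h_spin cl_neq0 (a := false) (c := false)
    (p := false) (A := id) _ _ _ _ rho0_alpha alpha_adj _ (@cl_evenE R m)
    (@cl_oddE R m)) => //.
  + by move=> v s; rewrite scale1r.
  + by move=> s t; rewrite mul1r.
  + by move=> s; rewrite scale1r.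
- apply: (embeds_in_wedge rho0_module h_spin cl_neq0 (a := true) (c := false)
    (p := false) (A := alpha) _ _ _ _ rho0_alpha alpha_adj _ (@cl_evenE R m)
    (@cl_oddE R m)) => //.
  + exact: inv_inj (@cl_alphaK R m).
  + exact: rho0_alpha.
  + by move=> s; rewrite scale1r.
Qed.

End Model0.

Section Model1.
Hypothesis m_mod : (m %% 4)%N = 1%N.
Local Notation rho := (@rho1 R m).
Local Notation J := (@opJ1 R m).

Let m_odd : odd m. Proof. by rewrite odd_mod4 m_mod. Qed.
Let m_gt0 : (0 < m)%N. Proof. by case: m m_odd. Qed.
Let omega_sqr : omega * omega = 1.
Proof. by rewrite cl_omega_sqr odd_bin2_mod4 m_mod scale1r. Qed.
Let omega_comm x : omega * cl_vec x = cl_vec x * omega.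
Proof. by rewrite omega_vec // m_odd scale1r. Qed.
Let alpha_omega : alpha omega = - omega.
Proof. by rewrite cl_alpha_omega m_odd scaleN1r. Qed.
Let alphal := @cl_alpha_linear R m.

Lemma rho1_module : clifford_module rho.
Proof.
split=> [s a u v|v a s t|v s]; rewrite /rho1.
- rewrite !linearP !cl_vec_linear mulrDl mulrDr addrACA -scalerAl -scalerAr.
  by rewrite -scalerDr.
- by rewrite alphal !mulrDr !mulrDl addrACA -!(scalerAr, scalerAl) -scalerDr.
- rewrite (linD alphal) !cl_alphaM cl_alphaK !cl_alpha_vec alpha_omega.
  rewrite !mulrDr mulrDl !(mulrN, mulNr) ![in LHS]opprK cl_vecK !mulrA.
  rewrite omega_comm omega_sqr mul1r cl_vecKr addrA addrK dotneg_split opprD.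
  by rewrite scalerDl.
Qed.

Lemma rho1_sym v s t : cl_dot (rho v s) t = cl_dot s (rho v t).
Proof.
rewrite (bilDl (@cl_dot_bilinear R m)) (bilDr (@cl_dot_bilinear R m)).
rewrite cl_dot_vec_mul -mulrA cl_dot_omega cl_dot_mul_vec cl_dot_alpha.
rewrite odd_bin2_mod4 m_mod mul1r !cl_alphaM alpha_omega cl_alpha_vec.
by rewrite mulrN !mulNr opprK.
Qed.

Lemma rho1_spin : spin_scalar_product rho (@cl_dot R m).
Proof.
apply: symmetric_spin_scalar_product rho1_sym.
- exact: rho1_module.
- exact: cl_dot_bilinear.
- exact: cl_dotC.
- exact: cl_dot_pos.
Qed.

(** As for [rho0], but here [x * A 1 = alpha (A 1) * x] for all vectors [x]. *)
Lemma rho1_commutant A : linear A -> commutes_up_to rho false A ->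
  exists p, forall s, A s = p *: s.
Proof.
move=> Al Ac.
have rhol x s : rho (row_mx x 0) s = cl_vec x * s.
  by rewrite /rho1 row_mxKl row_mxKr cl_vec0 mulr0 addr0.
have rhor x s : rho (row_mx 0 x) s = omega * alpha s * cl_vec x.
  by rewrite /rho1 row_mxKl row_mxKr cl_vec0 mul0r add0r.
have AE : forall s, A s = s * A 1.
  by apply: left_mul_commutant => // x s; rewrite -!rhol Ac scale1r.
exists (A 1 set0) => s; rewrite {1}AE {1}(@twisted_central _ _ (A 1)).
  by rewrite -scalerAr mulr1.
move=> i; have := Ac (row_mx 0 (delta_mx 0 i)) 1.
rewrite scale1r !rhor cl_vec_delta [in LHS]AE.
have -> : alpha 1 = 1.
  by rewrite [LHS]cl_alpha_blade cards0 scale1r.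
rewrite mulr1 => /(congr1 ( *%R omega)).
rewrite /= !mulrA omega_sqr !mul1r => e.
have /(congr1 alpha) := e.
rewrite !cl_alphaM cl_alphaK !cl_alpha_blade cards1 expr1 !scaleN1r mulNr mulrN.
by move/oppr_inj => ->; rewrite -mulrA cl_gen_sqr mulr1.
Qed.

Lemma opJ1_linear : linear J.
Proof. by move=> a s t; rewrite /opJ1 alphal mulrDr scalerAr. Qed.

Lemma opJ1_sqr s : J (J s) = - s.
Proof.
rewrite /opJ1 cl_alphaM alpha_omega cl_alphaK mulNr mulrN mulrA omega_sqr.
by rewrite mul1r.
Qed.

Lemma rho1_opJ1 : commutes_up_to rho true J.
Proof.
move=> v s; rewrite /rho1 /opJ1 (linD alphal) !cl_alphaM !cl_alpha_vec.
rewrite alpha_omega cl_alphaK expr1 scaleN1r opprD mulrDr.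
by rewrite !(mulNr, mulrN) !opprK !mulrA omega_comm.
Qed.

Lemma rho1_embeddings (h : cl R m -> cl R m -> R) : spin_scalar_product rho h ->
  let j A := j_rho rho (form_op h A) in
    (forall f, equivariant_embedding rho f ->
       linear_combination [:: j_rho rho h; j J] f)
    /\ embeds_in rho (j_rho rho h) (@dual_vee2 R (cl R m))
    /\ embeds_in rho (j J) (@dual_vee2 R (cl R m)).
Proof.
move=> h_spin j.
have comm P : linear P -> commutes_up_to rho false P ->
    exists p Q, (forall s, P s = p *: s + Q s)
                /\ adjoint_up_to (@cl_dot R m) true Q.
  move=> Pl /(rho1_commutant Pl) [p Pp]; exists p, (fun=> 0); split=> [s|s t].
    by rewrite addr0.
  rewrite -(scale0r 0) (bilZl (@cl_dot_bilinear R m)).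
  by rewrite (bilZr (@cl_dot_bilinear R m)); ring.
have [h_rep h_adj] := reference_product rho1_module rho1_spin cl_dot_represents
  cl_neq0 comm h_spin.
have [h_bil _ _ _] := h_spin.
have J_adj : adjoint_up_to h true J.
  apply: h_adj => s t; rewrite /opJ1 cl_dot_omega cl_dot_alpha cl_alphaM.
  rewrite odd_bin2_mod4 m_mod alpha_omega mulNr mul1r expr1 mulN1r.
  by rewrite (bilNr (@cl_dot_bilinear R m)).
have Jl := opJ1_linear.
split; last split.
- move=> f f_emb.
  have [|A [D [[Al Dl] Ac Dc fE]]] :=
    equivariant_embedding_factor rho1_module h_spin h_rep _ f_emb.
    by rewrite addn_gt0 m_gt0.
  have [p Ap] := rho1_commutant Al Ac.
  have [||q Dq] := @rho1_commutant (D \o J).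
  + by move=> a s t; rewrite /= Jl Dl.
  + move=> v s; rewrite /= rho1_opJ1 scale1r !scaleN1r (linN Dl) Dc.
    by rewrite expr1 scaleN1r opprK.
  (* The sign of q comes from [J (J s) = - s]. *)
  exists (fun i => nth 0 [:: p; - q] i) => v s t.
  rewrite !big_ord_recl big_ord0 addr0 /= fE Ap (bilZl h_bil); congr (_ + _).
  rewrite -[rho v s in LHS]opprK -opJ1_sqr -[D _]/((D \o J) _) Dq.
  by rewrite (linN Jl) scalerN -scaleNr (bilZl h_bil).
- apply: (embeds_in_vee2 rho1_module h_spin cl_neq0 (a := false) (c := false)
    (A := id)) => //.
  + by move=> v s; rewrite scale1r.
  + by move=> s t; rewrite mul1r.
- apply: (embeds_in_vee2 rho1_module h_spin cl_neq0 (a := true) (c := true)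
    (A := J)) => //.
  + by move=> s t /(congr1 J); rewrite !opJ1_sqr => /oppr_inj.
  + exact: rho1_opJ1.
Qed.

End Model1.
End RealModels.

(** * The complex model *)

Section SignedOperators.
Variables (R : realType) (n : nat) (S : lmodType R).
Variables (rho : 'rV[R]_n -> S -> S) (h : S -> S -> R) (E : S -> S).
Hypothesis h_bil : bilinear_form h.

(** [A] has the sign [a] against Clifford multiplication, the adjoint sign [c]
    for [h], and the parity [p] for the grading operator [E]. *)
Definition signed_operator (a c p : bool) (A : S -> S) : Prop :=
  [/\ linear A, injective A, commutes_up_to rho a A, adjoint_up_to h c A
    & forall s, E (A s) = (-1) ^+ p *: A (E s)].

Lemma signed_operator_comp a c p a' c' p' (q : bool) A B :
  signed_operator a c p A -> signed_operator a' c' p' B ->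
  (forall s, B (A s) = (-1) ^+ q *: A (B s)) ->
  signed_operator (a (+) a') (c (+) c' (+) q) (p (+) p') (A \o B).
Proof.
move=> [Al Ai Ac Aadj AE] [Bl Bi Bc Badj BE] AB; split=> [x s t||v s|s t|s] /=.
- by rewrite Bl Al.
- exact: inj_comp.
- by rewrite Bc (linZ Al) Ac scalerA signr_addb mulrC.
- rewrite Aadj Badj AB (bilZr h_bil) !signr_addb; ring.
- by rewrite AE BE (linZ Al) scalerA signr_addb.
Qed.

End SignedOperators.

Section ComplexModel.
Variables (R : realType) (m : nat).
Implicit Types (s t : clC R m) (x y : cl R m) (A B : {set 'I_m}).
Local Notation omega := (cl_omega R m).
Local Notation alpha := (@cl_alpha R m).

(** Elements of the complexified algebra are handled as pairs [(x, y)] of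
    elements of the real form, standing for [x + i y]. *)
Definition clC_mk x y : clC R m := [ffun A : {set 'I_m} => Complex (x A) (y A)].
Definition clC_re s : cl R m :=
  [ffun A : {set 'I_m} => complex.Re ((s : cl R[i] m) A)].
Definition clC_im s : cl R m :=
  [ffun A : {set 'I_m} => complex.Im ((s : cl R[i] m) A)].

Lemma clC_re_mk x y : clC_re (clC_mk x y) = x.
Proof. by apply/ffunP=> A; rewrite !ffunE. Qed.

Lemma clC_im_mk x y : clC_im (clC_mk x y) = y.
Proof. by apply/ffunP=> A; rewrite !ffunE. Qed.

Lemma clC_ext s t : clC_re s = clC_re t -> clC_im s = clC_im t -> s = t.
Proof.
move=> /ffunP re_st /ffunP im_st; apply/ffunP=> A.
move: (re_st A) (im_st A); rewrite !ffunE.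
by case: ((s : cl R[i] m) A) => a b; case: ((t : cl R[i] m) A) => c d /= -> ->.
Qed.

Lemma clC_re_linear : linear clC_re.
Proof.
move=> a s t; apply/ffunP=> A; rewrite !ffunE.
by case: ((s : cl R[i] m) A) => b c; case: ((t : cl R[i] m) A) => d e /=; ring.
Qed.

Lemma clC_im_linear : linear clC_im.
Proof.
move=> a s t; apply/ffunP=> A; rewrite !ffunE.
by case: ((s : cl R[i] m) A) => b c; case: ((t : cl R[i] m) A) => d e /=; ring.
Qed.

Lemma Re_sum (I : finType) (F : I -> R[i]) :
  complex.Re (\sum_i F i) = \sum_i complex.Re (F i).
Proof. by apply: (big_morph (@complex.Re R)) => // [[a b] [c d]]. Qed.

Lemma Im_sum (I : finType) (F : I -> R[i]) :
  complex.Im (\sum_i F i) = \sum_i complex.Im (F i).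
Proof. by apply: (big_morph (@complex.Im R)) => // [[a b] [c d]]. Qed.

Lemma clC_re_ofM x s : clC_re (clC_of x * s) = x * clC_re s.
Proof.
apply/ffunP=> C; rewrite !ffunE Re_sum; apply: eq_bigr => A _; rewrite !ffunE.
by case: (cl_inv _ _); case: ((s : cl R[i] m) _) => a b; rewrite /=; ring.
Qed.

Lemma clC_im_ofM x s : clC_im (clC_of x * s) = x * clC_im s.
Proof.
apply/ffunP=> C; rewrite !ffunE Im_sum; apply: eq_bigr => A _; rewrite !ffunE.
by case: (cl_inv _ _); case: ((s : cl R[i] m) _) => a b; rewrite /=; ring.
Qed.

Lemma clC_re_Mof x s : clC_re (s * clC_of x) = clC_re s * x.
Proof.
apply/ffunP=> C; rewrite !ffunE Re_sum; apply: eq_bigr => A _; rewrite !ffunE.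
by case: (cl_inv _ _); case: ((s : cl R[i] m) _) => a b; rewrite /=; ring.
Qed.

Lemma clC_im_Mof x s : clC_im (s * clC_of x) = clC_im s * x.
Proof.
apply/ffunP=> C; rewrite !ffunE Im_sum; apply: eq_bigr => A _; rewrite !ffunE.
by case: (cl_inv _ _); case: ((s : cl R[i] m) _) => a b; rewrite /=; ring.
Qed.

Lemma clC_re_opI s : clC_re (opI s) = - clC_im s.
Proof.
apply/ffunP=> A; rewrite !ffunE.
by case: ((s : cl R[i] m) A) => a b; rewrite /=; ring.
Qed.

Lemma clC_im_opI s : clC_im (opI s) = clC_re s.
Proof.
apply/ffunP=> A; rewrite !ffunE.
by case: ((s : cl R[i] m) A) => a b; rewrite /=; ring.
Qed.

Lemma clC_re_alpha s : clC_re (clC_alpha s) = alpha (clC_re s).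
Proof.
apply/ffunP=> A; rewrite !ffunE !sign_card.
by case: (odd _); case: ((s : cl R[i] m) A) => a b; rewrite /=; ring.
Qed.

Lemma clC_im_alpha s : clC_im (clC_alpha s) = alpha (clC_im s).
Proof.
apply/ffunP=> A; rewrite !ffunE !sign_card.
by case: (odd _); case: ((s : cl R[i] m) A) => a b; rewrite /=; ring.
Qed.

Lemma clC_re_conj s : clC_re (clC_conj s) = clC_re s.
Proof. by apply/ffunP=> A; rewrite !ffunE; case: ((s : cl R[i] m) A). Qed.

Lemma clC_im_conj s : clC_im (clC_conj s) = - clC_im s.
Proof. by apply/ffunP=> A; rewrite !ffunE; case: ((s : cl R[i] m) A). Qed.

(** Rewrite rules that compute the two components of an expression. *)
Definition clC_reE := (clC_re_ofM, clC_re_Mof, clC_re_opI, clC_re_alpha,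
  clC_re_conj, linD clC_re_linear, linZ clC_re_linear, linN clC_re_linear,
  clC_re_mk).
Definition clC_imE := (clC_im_ofM, clC_im_Mof, clC_im_opI, clC_im_alpha,
  clC_im_conj, linD clC_im_linear, linZ clC_im_linear, linN clC_im_linear,
  clC_im_mk).
Definition clCE := (clC_reE, clC_imE).

Lemma clC_mkE s : clC_mk (clC_re s) (clC_im s) = s.
Proof. by apply: clC_ext; rewrite !clCE. Qed.

Lemma clC_mk_linear a x y x' y' :
  clC_mk (a *: x + x') (a *: y + y') = a *: clC_mk x y + clC_mk x' y'.
Proof. by apply: clC_ext; rewrite !clCE. Qed.

Lemma opI_linear : linear (@opI R m).
Proof.
move=> a s t; apply: clC_ext; rewrite !clCE; last by [].
by rewrite scalerN opprD.
Qed.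

Lemma clC_alpha_linear : linear (@clC_alpha R m).
Proof. by move=> a s t; apply: clC_ext; rewrite !clCE cl_alpha_linear. Qed.

Lemma opJ23_linear : linear (@opJ23 R m).
Proof.
move=> a s t; apply: clC_ext; rewrite /opJ23 !clCE.
  by rewrite mulrDr -scalerAr.
by rewrite opprD -scalerN mulrDr -scalerAr.
Qed.

Lemma opI_sqr s : opI (opI s) = - s.
Proof. by apply: clC_ext; rewrite !clCE. Qed.

Lemma clC_alphaK : involutive (@clC_alpha R m).
Proof. by move=> s; apply: clC_ext; rewrite !clCE cl_alphaK. Qed.

Lemma clC_evenE s : clC_even s -> clC_alpha s = s.
Proof. exact: cl_evenE. Qed.

Lemma clC_oddE s : clC_odd s -> clC_alpha s = - s.
Proof. exact: cl_oddE. Qed.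

Lemma clC_neq0 : exists s : clC R m, s != 0.
Proof. by exists 1; apply: oner_neq0. Qed.

(** The real part of the Hermitian product for which the blades are
    orthonormal. *)
Definition clC_dot s t : R :=
  cl_dot (clC_re s) (clC_re t) + cl_dot (clC_im s) (clC_im t).

Local Notation dotB := (@cl_dot_bilinear R m).

Lemma clC_dotC : Defs.symmetric_form clC_dot.
Proof. by move=> s t; congr (_ + _); apply: cl_dotC. Qed.

Lemma clC_dot_bilinear : bilinear_form clC_dot.
Proof.
have H t : scalar (clC_dot^~ t).
  move=> a s s'; rewrite /clC_dot clC_re_linear clC_im_linear.
  by rewrite !(bilDl dotB) !(bilZl dotB); ring.
by split=> // s a t t'; rewrite clC_dotC (H s a t t') !(clC_dotC _ s).
Qed.

Lemma clC_dot_pos : pos_def_form clC_dot.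
Proof.
have dot_ge0 x : 0 <= cl_dot x x.
  have [->|/cl_dot_pos/ltW//] := eqVneq x 0.
  by rewrite -(scale0r 0) (bilZl dotB) mul0r.
move=> s s_neq0; rewrite lt_neqAle addr_ge0 // andbT eq_sym paddr_eq0 //.
apply: contra s_neq0 => /andP[re0 im0]; apply/eqP/clC_ext.
  rewrite (lin0 clC_re_linear); apply/eqP; apply: contraTT re0 => /cl_dot_pos.
  by move/gt_eqF ->.
rewrite (lin0 clC_im_linear); apply/eqP; apply: contraTT im0 => /cl_dot_pos.
by move/gt_eqF ->.
Qed.

Lemma clC_dot_represents : represents_forms clC_dot.
Proof.
move=> b b_bil; have [b_l b_r] := b_bil.
exists (fun s => clC_mk [ffun A => b s (clC_mk (blade R A) 0)]
                        [ffun A => b s (clC_mk 0 (blade R A))]).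
  move=> a s t; rewrite -clC_mk_linear.
  by congr clC_mk; apply/ffunP=> A; rewrite !ffunE b_l.
move=> s t; rewrite /clC_dot clC_re_mk clC_im_mk.
rewrite -(cl_dot_riesz (phi := fun x => b s (clC_mk x 0))); last first.
  by move=> a x y; rewrite -b_r -clC_mk_linear scaler0 addr0.
rewrite -(cl_dot_riesz (phi := fun y => b s (clC_mk 0 y))); last first.
  by move=> a x y; rewrite -b_r -clC_mk_linear scaler0 addr0.
rewrite -(bilDr b_bil) -[clC_mk _ 0]scale1r -clC_mk_linear !scale1r.
by rewrite addr0 add0r clC_mkE.
Qed.

Lemma odd_bin2_23 : ((m %% 4)%N = 2%N \/ (m %% 4)%N = 3%N) ->
  odd 'C(m, 2).
Proof. by rewrite odd_bin2_mod4 => -[->|->]. Qed.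

(** Right and left multiplication by [omega] differ by [alpha] for even [m]. *)
Lemma cl_mul_omega (m_gt0 : (0 < m)%N) x :
  x * omega = omega * (if odd m then x else alpha x).
Proof.
have omega2 (u : 'rV[R]_m) :
    cl_vec u * omega = (-1) ^+ (~~ odd m) *: (omega * cl_vec u).
  by rewrite omega_vec // scalerA -expr2 sqrr_sign scale1r.
elim/cl_ind: x => [a x y xE yE||i x xE].
- rewrite mulrDl -scalerAl xE yE; case: ifP => _.
    by rewrite mulrDr scalerAr.
  by rewrite cl_alpha_linear mulrDr scalerAr.
- by rewrite [alpha 1]cl_alpha_blade cards0 scale1r if_same mulr1 mul1r.
- rewrite -cl_vec_delta -mulrA xE mulrA omega2 cl_alphaM cl_alpha_vec.
  case: (odd m); first by rewrite scale1r mulrA.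
  by rewrite scaleN1r !mulNr mulrN mulrA.
Qed.

(** If the twisted conjugate [b] of [a] does not depend on the generator, then
    only the coefficients at the empty and the full blade survive: any other
    blade contains one generator and misses another. *)
Lemma twisted_conjugate_const a b : (0 < m)%N ->
  (forall i, cl_gen R i * alpha a * cl_gen R i = b) ->
  exists p q, a = p *: 1 + q *: omega /\ b = p *: 1 - q *: omega.
Proof.
move=> m_gt0 ab.
have bB i B : b B = (-1) ^+ (i \in B) * a B by rewrite -(ab i) gen_alpha_gen.
pose i0 := Ordinal m_gt0.
have T0 : [set: 'I_m] != set0 by apply/set0Pn; exists i0; rewrite inE.
exists (a set0), (a setT); rewrite cl_omegaE.
have mid0 B : B != set0 -> B != setT -> a B = 0 /\ b B = 0.
  move=> /set0Pn[i iB] BT; have [j jB] : exists j, j \notin B.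
    apply/existsP; rewrite -negb_forall; apply: contra BT => /forallP jB.
    by apply/eqP/setP=> j; rewrite inE jB.
  by have := bB i B; have := bB j B; rewrite iB (negPf jB); split; lra.
split; apply/ffunP=> B; rewrite !ffunE.
- have [->|B0] := eqVneq B set0.
    by rewrite eq_sym (negPf T0) mulr1 mulr0 addr0.
  have [->|BT] := eqVneq B setT; first by rewrite mulr1 mulr0 add0r.
  by rewrite !mulr0 addr0 (mid0 B B0 BT).1.
- have [->|B0] := eqVneq B set0.
    by rewrite eq_sym (negPf T0) (bB i0) inE mulr0 mulr1 subr0 mul1r.
  have [->|BT] := eqVneq B setT.
    by rewrite (bB i0) inE mulr0 add0r mulr1 mulN1r.
  by rewrite !mulr0 subr0 (mid0 B B0 BT).2.
Qed.

Section Model23.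
Hypotheses (m_gt0 : (0 < m)%N).
Hypothesis m_mod : (m %% 4)%N = 2%N \/ (m %% 4)%N = 3%N.
Local Notation rho := (@rho23 R m).
Implicit Types v : 'rV[R]_(m + m).

Let omega_sqr : omega * omega = -1.
Proof. by rewrite cl_omega_sqr odd_bin2_23 // scaleN1r. Qed.

Lemma clC_re_rho v s : clC_re (rho v s)
  = cl_vec (lsubmx v) * clC_re s - alpha (clC_im s) * cl_vec (rsubmx v).
Proof. by rewrite /rho23 !clCE. Qed.

Lemma clC_im_rho v s : clC_im (rho v s)
  = cl_vec (lsubmx v) * clC_im s + alpha (clC_re s) * cl_vec (rsubmx v).
Proof. by rewrite /rho23 !clCE. Qed.

Lemma rho23_module : clifford_module rho.
Proof.
split=> [s a u v|v a s t|v s].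
- apply: clC_ext; rewrite !(clC_re_rho, clC_im_rho, clCE) !linearP.
    rewrite !cl_vec_linear mulrDl mulrDr opprD addrACA -scalerAl -scalerAr.
    by rewrite -scalerBr.
  rewrite !cl_vec_linear mulrDl mulrDr addrACA -scalerAl -scalerAr.
  by rewrite -scalerDr.
- apply: clC_ext; rewrite !(clC_re_rho, clC_im_rho, clCE) cl_alpha_linear.
    rewrite mulrDl mulrDr opprD addrACA -scalerAl -scalerAr.
    by rewrite -scalerBr.
  rewrite mulrDl mulrDr addrACA -scalerAl -scalerAr.
  by rewrite -scalerDr.
- have al := @cl_alpha_linear R m.
  rewrite dotneg_split opprD scalerDl.
  apply: clC_ext; rewrite !(clC_re_rho, clC_im_rho, clCE).
    rewrite (linD al) !cl_alphaM cl_alphaK !cl_alpha_vec mulrDl mulrDr cl_vecK.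
    rewrite !(mulrN, mulNr) cl_vecKr opprD ![- - (_ * _)]opprK mulrA addrA.
    by rewrite subrK; congr (_ + _); apply: opprK.
  rewrite (linB al) !cl_alphaM cl_alphaK !cl_alpha_vec mulrDl mulrDr cl_vecK.
  rewrite !(mulrN, mulNr) cl_vecKr mulrA addrA addrK.
  by congr (_ + _); apply: opprK.
Qed.

Lemma rho23_sym v s t : clC_dot (rho v s) t = clC_dot s (rho v t).
Proof.
rewrite /clC_dot !clC_re_rho !clC_im_rho !(bilDl dotB, bilDr dotB).
rewrite !(bilNl dotB, bilNr dotB) !cl_dot_vec_mul.
rewrite !cl_dot_mul_vec !cl_dot_alpha !cl_alphaM !cl_alpha_vec.
by rewrite !mulrN !(bilNr dotB); ring.
Qed.

Lemma rho23_spin : spin_scalar_product rho clC_dot.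
Proof.
apply: symmetric_spin_scalar_product rho23_sym.
- exact: rho23_module.
- exact: clC_dot_bilinear.
- exact: clC_dotC.
- exact: clC_dot_pos.
Qed.

(** The operator [s |-> c(s) omega], which together with [opI] generates the
    quaternion algebra of operators that commute with [rho]. *)
Definition clC_conj_omega s : clC R m := clC_conj s * clC_of omega.
Local Notation T := clC_conj_omega.

(** [A] commutes with left multiplication by the real form, so it is determined
    by [a = A 1] and [b = A i].  Commuting with [s |-> i alpha(s) x] makes [b]
    the twisted conjugate of [i a] by every generator. *)
Lemma rho23_commutant (A : clC R m -> clC R m) :
  linear A -> commutes_up_to rho false A ->
  exists p p' q q', forall s,
    A s = p *: s + (p' *: opI s + q *: T s + q' *: opI (T s)).
Proof.
move=> Al Ac.
have vec0 : cl_vec (0 : 'rV[R]_m) = 0 by exact: cl_vec0.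
have al0 := lin0 (@cl_alpha_linear R m).
have rel u s : clC_re (rho (row_mx u 0) s) = cl_vec u * clC_re s.
  by rewrite clC_re_rho row_mxKl row_mxKr vec0 mulr0 subr0.
have iml u s : clC_im (rho (row_mx u 0) s) = cl_vec u * clC_im s.
  by rewrite clC_im_rho row_mxKl row_mxKr vec0 mulr0 addr0.
have rer u s : clC_re (rho (row_mx 0 u) s) = - (alpha (clC_im s) * cl_vec u).
  by rewrite clC_re_rho row_mxKl row_mxKr vec0 mul0r add0r.
have imr u s : clC_im (rho (row_mx 0 u) s) = alpha (clC_re s) * cl_vec u.
  by rewrite clC_im_rho row_mxKl row_mxKr vec0 mul0r add0r.
pose a := A (clC_mk 1 0); pose b := A (clC_mk 0 1).
have left_mul c d x : A (clC_mk (x * c) (x * d))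
    = clC_mk (x * clC_re (A (clC_mk c d))) (x * clC_im (A (clC_mk c d))).
  elim/cl_ind: x => [k x y xE yE||i x xE].
  - by rewrite !mulrDl -!scalerAl clC_mk_linear Al xE yE -clC_mk_linear.
  - by rewrite !mul1r clC_mkE.
  - have -> : clC_mk (cl_gen R i * x * c) (cl_gen R i * x * d)
        = rho (row_mx (delta_mx 0 i) 0) (clC_mk (x * c) (x * d)).
      by apply: clC_ext; rewrite ?rel ?iml !clCE cl_vec_delta mulrA.
    rewrite Ac scale1r xE.
    by apply: clC_ext; rewrite ?rel ?iml !clCE cl_vec_delta mulrA.
have AE x y : A (clC_mk x y) = clC_mk (x * clC_re a + y * clC_re b)
                                     (x * clC_im a + y * clC_im b).
  have -> : clC_mk x y = 1 *: clC_mk (x * 1) (x * 0) + clC_mk (y * 0) (y * 1).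
    by rewrite -clC_mk_linear !mulr1 !mulr0 !scale1r addr0 add0r.
  by rewrite Al !left_mul -clC_mk_linear !scale1r.
have gen2 i : cl_gen R i * clC_re b = - (alpha (clC_im a) * cl_gen R i)
           /\ cl_gen R i * clC_im b = alpha (clC_re a) * cl_gen R i.
  have e := Ac (row_mx 0 (delta_mx 0 i)) (clC_mk 1 0).
  have e0 : rho (row_mx 0 (delta_mx 0 i)) (clC_mk 1 0) = clC_mk 0 (cl_gen R i).
    apply: clC_ext; rewrite ?rer ?imr !clCE ?al0 ?mul0r ?oppr0 //.
    by rewrite [alpha 1]cl_alpha_blade cards0 scale1r mul1r cl_vec_delta.
  move: e; rewrite e0 AE !mul0r !add0r scale1r => e.
  have := congr1 clC_re e; have := congr1 clC_im e.
  by rewrite rer imr !clCE cl_vec_delta.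
have [p [q [a1E b2E]]] : exists p q, clC_re a = p *: 1 + q *: omega
    /\ clC_im b = p *: 1 - q *: omega.
  apply: twisted_conjugate_const => // i.
  by rewrite -mulrA -(gen2 i).2 mulrA cl_gen_sqr mul1r.
have [p' [q' [a2E b1E]]] : exists p q, clC_im a = p *: 1 + q *: omega
    /\ - clC_re b = p *: 1 - q *: omega.
  apply: twisted_conjugate_const => // i.
  rewrite -mulrA -[alpha _ * _]opprK -(gen2 i).1 mulrN.
  by rewrite mulrA cl_gen_sqr mul1r.
exists p, p', q, q' => s; rewrite -{1}[s]clC_mkE AE.
rewrite -[clC_re b]opprK b1E b2E a1E a2E.
apply: clC_ext; rewrite !clCE !(mulrN, mulrDr, mulNr, opprD, opprK);
  rewrite -!scalerAr !mulr1 scalerN -!addrA.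
  by congr (_ + _); rewrite addrCA.
rewrite [X in _ + X = _]addrCA [LHS]addrCA; congr (_ + (_ + _)).
by rewrite addrC.
Qed.

(** The identification of the quaternion algebra in terms of [opJ23] depends on
    the parity of [m]. *)
Lemma conj_omegaE s : T s = if odd m then opJ23 s else clC_alpha (opJ23 s).
Proof.
case m_odd: (odd m); apply: clC_ext; rewrite /T /opJ23 !clCE;
  by rewrite ?cl_alphaM ?cl_alpha_omega cl_mul_omega // m_odd ?scale1r.
Qed.

Lemma clC_dot_opI : adjoint_up_to clC_dot true (@opI R m).
Proof.
move=> s t; rewrite /clC_dot !clCE (bilNl dotB) (bilNr dotB); ring.
Qed.

Lemma clC_dot_conj_omega : adjoint_up_to clC_dot true T.
Proof.
have dot_omega x y : cl_dot (x * omega) y = - cl_dot x (y * omega).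
  by rewrite cl_omegaE cl_dot_mul_blade cl_inv_setT odd_bin2_23 // mulN1r.
move=> s t; rewrite /clC_dot /T !clCE !mulNr (bilNl dotB) (bilNr dotB).
by rewrite !dot_omega; ring.
Qed.

Lemma conj_omega_opI s : T (opI s) = - opI (T s).
Proof. by apply: clC_ext; rewrite /T !clCE ?mulNr ?opprK. Qed.

Lemma clC_dot_opJ23 : adjoint_up_to clC_dot true (@opJ23 R m).
Proof.
move=> s t; rewrite /clC_dot /opJ23 !clCE !cl_dot_omega odd_bin2_23 //.
by rewrite !mulrN !(bilNl dotB, bilNr dotB) /=; ring.
Qed.

Lemma clC_dot_alpha : adjoint_up_to clC_dot false (@clC_alpha R m).
Proof. by move=> s t; rewrite /clC_dot !clCE !cl_dot_alpha mul1r. Qed.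

Lemma opI_opJ23 s : opJ23 (opI s) = - opI (opJ23 s).
Proof. by apply: clC_ext; rewrite /opJ23 !clCE ?mulrN ?opprK. Qed.

Lemma clC_alpha_opI s : clC_alpha (opI s) = opI (clC_alpha s).
Proof.
by apply: clC_ext; rewrite !clCE // (linN (@cl_alpha_linear R m)).
Qed.

Lemma clC_alpha_opJ23 s :
  clC_alpha (opJ23 s) = (-1) ^+ odd m *: opJ23 (clC_alpha s).
Proof.
apply: clC_ext; rewrite /opJ23 !clCE cl_alphaM cl_alpha_omega -scalerAl //.
by rewrite (linN (@cl_alpha_linear R m)).
Qed.

Lemma opJ23_sqr s : opJ23 (opJ23 s) = - s.
Proof.
by apply: clC_ext; rewrite /opJ23 !clCE ?mulrN ?opprK mulrA omega_sqr mulN1r.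
Qed.

Lemma rho23_opI v s : opI (rho v s) = rho v (opI s).
Proof.
have al := @cl_alpha_linear R m.
apply: clC_ext; rewrite !(clC_re_rho, clC_im_rho, clCE).
  by rewrite opprD mulrN.
by rewrite (linN al) mulNr.
Qed.

Lemma rho23_alpha v s : clC_alpha (rho v s) = - rho v (clC_alpha s).
Proof.
have al := @cl_alpha_linear R m.
apply: clC_ext; rewrite !(clC_re_rho, clC_im_rho, clCE).
  rewrite (linB al) !cl_alphaM !cl_alpha_vec !(mulrN, mulNr) opprK opprD.
  by rewrite opprK.
by rewrite (linD al) !cl_alphaM !cl_alpha_vec !(mulrN, mulNr) opprD.
Qed.

Lemma rho23_opJ23 v s : opJ23 (rho v s) = (-1) ^+ (~~ odd m) *: rho v (opJ23 s).
Proof.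
have al := @cl_alpha_linear R m.
apply: clC_ext; rewrite /opJ23 !(clC_re_rho, clC_im_rho, clCE);
  rewrite !cl_alphaM cl_alpha_omega ?(linN al) ?mulrN mulrDr ?mulrN !mulrA;
  rewrite omega_vec //;
  case: (odd m);
  rewrite !(expr0, expr1, scale1r, scaleN1r, mulrN, mulNr, opprD, opprK);
  by rewrite ?mulrA.
Qed.

Section Embeddings.
Variable h : clC R m -> clC R m -> R.
Hypothesis h_spin : spin_scalar_product rho h.
Local Notation E := (@clC_alpha R m).
Local Notation I := (@opI R m).
Local Notation J := (@opJ23 R m).
Local Notation K := (@opK R m).
Local Notation signed := (signed_operator rho h E).
Local Notation j A := (j_rho rho (form_op h A)).

Let h_bil : bilinear_form h. Proof. by case: h_spin. Qed.

Let commutant_skew P : linear P -> commutes_up_to rho false P ->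
  exists p Q, (forall s, P s = p *: s + Q s) /\ adjoint_up_to clC_dot true Q.
Proof.
move=> Pl /(rho23_commutant Pl) [p [p' [q [q' PE]]]].
exists p, (fun s => p' *: opI s + q *: T s + q' *: opI (T s)); split=> // s t.
rewrite !(bilDl clC_dot_bilinear, bilDr clC_dot_bilinear).
rewrite !(bilZl clC_dot_bilinear, bilZr clC_dot_bilinear).
rewrite clC_dot_opI clC_dot_conj_omega clC_dot_opI clC_dot_conj_omega.
by rewrite conj_omega_opI (bilNr clC_dot_bilinear); ring.
Qed.

Let h_reference := reference_product rho23_module rho23_spin
  clC_dot_represents clC_neq0 commutant_skew h_spin.

Lemma signed_id : signed false false false id.
Proof.
by split=> // [v s|s t|s]; rewrite ?scale1r ?mul1r.
Qed.

Lemma signed_I : signed false true false I.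
Proof.
split=> [||v s||s].
- exact: opI_linear.
- by move=> s t /(congr1 I); rewrite !opI_sqr => /oppr_inj.
- by rewrite rho23_opI scale1r.
- exact: h_reference.2 clC_dot_opI.
- by rewrite clC_alpha_opI scale1r.
Qed.

Lemma signed_J : signed (~~ odd m) true (odd m) J.
Proof.
split=> [||v s||s].
- exact: opJ23_linear.
- by move=> s t /(congr1 J); rewrite !opJ23_sqr => /oppr_inj.
- exact: rho23_opJ23.
- exact: h_reference.2 clC_dot_opJ23.
- exact: clC_alpha_opJ23.
Qed.

Lemma signed_E : signed true false false E.
Proof.
split=> [||v s||s].
- exact: clC_alpha_linear.
- exact: inv_inj clC_alphaK.
- by rewrite rho23_alpha scaleN1r.
- exact: h_reference.2 clC_dot_alpha.
- by rewrite scale1r.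
Qed.

Lemma signed_K : signed (~~ odd m) true (odd m) K.
Proof.
have := signed_operator_comp h_bil signed_I signed_J (q := true).
by apply=> s; rewrite opI_opJ23 scaleN1r.
Qed.

Lemma signed_E_comp a c p (A : clC R m -> clC R m) : signed a c p A ->
  signed (~~ a) (c (+) p) p (fun s => E (A s)).
Proof.
move=> A_signed; have [_ _ _ _ EA] := A_signed.
apply: (signed_operator_comp h_bil signed_E A_signed (q := p)) => s.
by rewrite EA scalerA -expr2 sqrr_sign scale1r.
Qed.

Lemma rho23_embedding_span f : equivariant_embedding rho f ->
  linear_combination [:: j id; j I; j J; j K; j E; j (fun s => E (I s));
                         j (fun s => E (J s)); j (fun s => E (K s))] f.
Proof.
move=> f_emb.
have [|A [D [[Al Dl] Ac Dc fE]]] :=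
  equivariant_embedding_factor rho23_module h_spin h_reference.1 _ f_emb.
  by rewrite addn_gt0 m_gt0.
have [p [p' [q [q' AE]]]] := rho23_commutant Al Ac.
have [||r [r' [u [u' DE]]]] := @rho23_commutant (D \o E).
- by move=> a s t; rewrite /= clC_alpha_linear Dl.
- move=> v s; rewrite /= rho23_alpha (linN Dl) Dc.
  by rewrite expr1 scaleN1r opprK scale1r.
have EJ s : J (E s) = (-1) ^+ odd m *: E (J s).
  by rewrite clC_alpha_opJ23 scalerA -expr2 sqrr_sign scale1r.
(* [D = (D \o E) \o E].  For odd m the last two signs come from [J E = - E J];
   for even m the factor E in [conj_omegaE] exchanges J, K with EJ, EK. *)
exists (fun i => nth 0 (if odd m then [:: p; p'; q; q'; r; r'; - u; - u']
                       else [:: p; p'; u; u'; r; r'; q; q']) i) => v s t.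
rewrite !big_ord_recl big_ord0 addr0 /= fE.
set w := rho v s.
have -> : D w = (D \o E) (E w) by rewrite /= clC_alphaK.
rewrite AE DE !conj_omegaE /j_rho /form_op -/w /opK.
case: (odd m) EJ => /= EJ; rewrite EJ ?expr1 ?expr0 ?scaleN1r ?scale1r.
  rewrite (linN opI_linear) !clC_alpha_opI.
  apply: etrans (congr2 +%R (bil_comb4 h_bil _ _ _ _ _ _ _ _ _)
                            (bil_comb4N h_bil _ _ _ _ _ _ _ _ _)) _.
  by rewrite !addrA.
rewrite !clC_alphaK !clC_alpha_opI.
apply: etrans (congr2 +%R (bil_comb4 h_bil _ _ _ _ _ _ _ _ _)
                          (bil_comb4 h_bil _ _ _ _ _ _ _ _ _)) _.
by ring.
Qed.

Lemma signed_vee a (A : clC R m -> clC R m) : signed a a false A ->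
  embeds_in rho (j A) (dual_Sp_vee_Sm (@clC_even R m) (@clC_odd R m)).
Proof.
move=> [Al Ai Ac Aadj EA]; have [_ _ Ec Eadj _] := signed_E.
exact: (embeds_in_vee rho23_module h_spin clC_neq0 Al Ai Ac Aadj Ec Eadj EA
  clC_evenE clC_oddE).
Qed.

Lemma signed_wedge c (A : clC R m -> clC R m) : signed (~~ c) c false A ->
  embeds_in rho (j A) (dual_Sp_wedge_Sm (@clC_even R m) (@clC_odd R m)).
Proof.
move=> [Al Ai Ac Aadj EA]; have [_ _ Ec Eadj _] := signed_E.
exact: (embeds_in_wedge rho23_module h_spin clC_neq0 Al Ai Ac Aadj Ec Eadj EA
  clC_evenE clC_oddE).
Qed.

Lemma signed_wedge2 c (A : clC R m -> clC R m) : signed (~~ c) c true A ->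
  embeds_in rho (j A) (dual_wedge2_sum (@clC_even R m) (@clC_odd R m)).
Proof.
move=> [Al Ai Ac Aadj EA]; have [_ _ Ec Eadj _] := signed_E.
exact: (embeds_in_wedge2 rho23_module h_spin clC_neq0 Al Ai Ac Aadj Ec Eadj EA
  clC_evenE clC_oddE).
Qed.

End Embeddings.
End Model23.
End ComplexModel.

Theorem theorem5p7 (R : realType) (m : nat) (m_ge1 : (1 <= m)%N) :
  ((m %% 4)%N = 0%N ->
    forall h : cl R m -> cl R m -> R,
    spin_scalar_product (@rho0 R m) h ->
    let Sp := @cl_even R m in
    let Sm := @cl_odd R m in
    let E := @cl_alpha R m in
    let j A := j_rho (@rho0 R m) (form_op h A) in
    (forall f, equivariant_embedding (@rho0 R m) f ->
       linear_combination [:: j_rho (@rho0 R m) h; j E] f)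
    /\ embeds_in (@rho0 R m) (j_rho (@rho0 R m) h) (dual_Sp_vee_Sm Sp Sm)
    /\ embeds_in (@rho0 R m) (j E) (dual_Sp_wedge_Sm Sp Sm))
  /\
  ((m %% 4)%N = 1%N ->
    forall h : cl R m -> cl R m -> R,
    spin_scalar_product (@rho1 R m) h ->
    let J := @opJ1 R m in
    let j A := j_rho (@rho1 R m) (form_op h A) in
    (forall f, equivariant_embedding (@rho1 R m) f ->
       linear_combination [:: j_rho (@rho1 R m) h; j J] f)
    /\ embeds_in (@rho1 R m) (j_rho (@rho1 R m) h) (@dual_vee2 R (cl R m))
    /\ embeds_in (@rho1 R m) (j J) (@dual_vee2 R (cl R m)))
  /\
  ((m %% 4)%N = 2%N \/ (m %% 4)%N = 3%N ->
    forall h : clC R m -> clC R m -> R,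
    spin_scalar_product (@rho23 R m) h ->
    let Sp := @clC_even R m in
    let Sm := @clC_odd R m in
    let Id := fun s : clC R m => s in
    let I := @opI R m in
    let J := @opJ23 R m in
    let K := @opK R m in
    let E := @clC_alpha R m in
    let EI := fun s => E (I s) in
    let EJ := fun s => E (J s) in
    let EK := fun s => E (K s) in
    let j A := j_rho (@rho23 R m) (form_op h A) in
    let in_vee A := embeds_in (@rho23 R m) (j A) (dual_Sp_vee_Sm Sp Sm) in
    let in_wedge A := embeds_in (@rho23 R m) (j A) (dual_Sp_wedge_Sm Sp Sm) in
    let in_wedge2 A := embeds_in (@rho23 R m) (j A) (dual_wedge2_sum Sp Sm) in
    (forall f, equivariant_embedding (@rho23 R m) f ->
       linear_combination
         [:: j Id; j I; j J; j K; j E; j EI; j EJ; j EK] f)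
    /\ ((m %% 4)%N = 2%N ->
          [/\ in_vee Id, in_vee J, in_vee K & in_vee EI]
          /\ [/\ in_wedge I, in_wedge E, in_wedge EJ & in_wedge EK])
    /\ ((m %% 4)%N = 3%N ->
          (in_vee Id /\ in_vee EI)
          /\ (in_wedge I /\ in_wedge E)
          /\ [/\ in_wedge2 J, in_wedge2 K, in_wedge2 EJ & in_wedge2 EK])).
Proof.
split; first by move=> m_mod h; apply: rho0_embeddings.
split; first by move=> m_mod h; apply: rho1_embeddings.
move=> m_mod h h_spin Sp Sm Id I J K E EI EJ EK j in_vee in_wedge in_wedge2.
have sI := signed_I m_ge1 m_mod h_spin.
have sJ := signed_J m_ge1 m_mod h_spin.
have sK := signed_K m_ge1 m_mod h_spin.
have sE := signed_E m_ge1 m_mod h_spin.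
have sEI := signed_E_comp m_ge1 m_mod h_spin sI.
have sEJ := signed_E_comp m_ge1 m_mod h_spin sJ.
have sEK := signed_E_comp m_ge1 m_mod h_spin sK.
have vee a A := @signed_vee R m m_ge1 m_mod h h_spin a A.
have wedge c A := @signed_wedge R m m_ge1 m_mod h h_spin c A.
have wedge2 c A := @signed_wedge2 R m m_ge1 m_mod h h_spin c A.
split; first by move=> f; apply: rho23_embedding_span.
split=> m_r; have m_odd := odd_mod4 m; rewrite m_r /= in m_odd;
  rewrite m_odd /= in sI sJ sK sE sEI sEJ sEK.
- split; split.
  + exact: (vee false) (signed_id h).
  + exact: (vee true) sJ.
  + exact: (vee true) sK.
  + exact: (vee true) sEI.
  + exact: (wedge true) sI.
  + exact: (wedge false) sE.
  + exact: (wedge true) sEJ.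
  + exact: (wedge true) sEK.
- split; last split; split.
  + exact: (vee false) (signed_id h).
  + exact: (vee true) sEI.
  + exact: (wedge true) sI.
  + exact: (wedge false) sE.
  + exact: (wedge2 true) sJ.
  + exact: (wedge2 true) sK.
  + exact: (wedge2 false) sEJ.
  + exact: (wedge2 false) sEK.
Qed.
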